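(* Let $p$ be an odd prime and $n,k\geq 1$. In the May spectral sequence for $T(n,k)$: (1) If the inner degree $t=2(p-1)(c_0+c_1p+\cdots+c_mp^m)$ with $0\leq c_i<p$ and the May filtration $M$ satisfies $M<2\,Sd(t)-s=2(c_0+\cdots+c_m)-s$, then $E_1^{s,t,M}T(n,k)=0$. (2) If $g$ is a $d_1$-cocycle in the exterior part $E[h'_{i,j}\mid k\leq i\leq n+k-1,\ j\geq 0]$ of the $E_1$-term satisfying $SI(g)=Sd(g)$, then $g$ is an infinite cocycle in the May spectral sequence for $T(n,k)$ and $\Phi(g)$ is an infinite cocycle in the May spectral sequence for $S(n,k)$.
   Context: $T(n,k)=P[\xi_i\mid k\leq i\leq n+k-1]$ over $\mathbb{Z}/p$ is the Hopf algebra with $|\xi_i|=2(p-1)(1+p+\cdots+p^{i-1})$ and $\Delta(\xi_i)=\xi_i\otimes1+\sum_{k\leq r\leq i-k}\xi_r\otimes\xi_{i-r}^{p^r}+1\otimes\xi_i$. Its May filtration is $M(\xi_i^{p^j})=2i-1$, extended to monomials by $M(\xi_i^{\sum j_lp^l})=\sum j_l M(\xi_i^{p^l})$ ($0\le j_l<p$), additively over distinct $\xi_i$, and to cobar elements by $M([\beta_1|\cdots|\beta_s])=\sum M(\beta_i)$; the filtration of the cobar complex yields the May spectral sequence $E_r^{s,t,M}T(n,k)$ ($s$ cohomological degree, $t$ inner degree, $M$ May filtration; $d_r:E_r^{s,t,M}\to E_r^{s+1,t,M-r}$) with $E_1=E[h'_{i,j}]\otimes P[b'_{i,j}]$ ($k\leq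 i\leq n+k-1$, $j\geq 0$), $h'_{i,j}$ the class of $[\xi_i^{p^j}]$ (degree $(1,2(p-1)(p^j+\cdots+p^{i+j-1}))$, filtration $2i-1$) and $b'_{i,j}$ the class of $\sum_{0<m<p}\binom{p}{m}/p\,\xi_i^{mp^j}\otimes\xi_i^{(p-m)p^j}$ (degree $(2,2(p-1)(p^{j+1}+\cdots+p^{i+j}))$, filtration $p(2i-1)$). $S(n,k)=\mathbb{Z}/p[t_k,t_{k+1},\dots]/(t_s^{p^n}-t_s)$ with coproduct $\Delta(t_s)=1\otimes t_s+\sum_{k\leq i\leq s-k}t_i\otimes t_{s-i}^{p^i}+t_s\otimes1$ for $s\leq n+k-1$, minus $b_{s-n,n-1}=\sum_{0<m<p}\binom pm/p\, t_{s-n}^{mp^{n-1}}\otimes t_{s-n}^{(p-m)p^{n-1}}$ for $s\geq n+k$, carries the May filtration $M(t_s^{p^j})=2s-1$ ($k\le s\le n+k-1$), $M(t_s^{p^j})=\max\{2s-1,pM(t_{s-n}^{p^{j+n-1}})+1\}$ ($s\ge n+k$), extended in the same way, giving its May spectral sequence. $\Phi$ is the map of May spectral sequences induced by the filtration-preserving Hopf algebra map $T(n,k)\to S(n,k)$, $\xi_i\mapsto t_i$. Sum of index: $SI(h'_{i,j})=SI(b'_{i,j})=i$, and for a monomial $g=x_1\cdots x_m$ in these generators $SI(g)=\sum SI(x_l)$ (for a linear combination of monomials with a common value of $SI$, $SI(g)$ is that value). Sum of degree: for $t=2(p-1)(c_0+c_1p+\cdots+c_mp^m)$ with $0\leq c_i<p$,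 $Sd(t)=c_0+\cdots+c_m$, and for a homogeneous element $g$ of inner degree $|g|$, $Sd(g)=Sd(|g|)$. An infinite cocycle is an element killed by all higher differentials. *)

(* Defs.v *)
From HB Require Import structures.
From mathcomp Require Import all_boot all_order all_algebra.
From mathcomp Require Import mpoly.

Unset Printing Implicit Defensive.

Import GRing.Theory.
Local Open Scope ring_scope.

Definition digit (p l e : nat) : nat := ((e %/ p ^ l) %% p)%N.
Definition digsum (p e : nat) : nat := (\sum_(l < e.+1) digit p l e)%N.

Section Cobar.
Variable p : nat.
Local Notation F := 'F_p.

(* The s-fold tensor power of a polynomial algebra on m generators is
   {mpoly F[s*m]}; variable v stands for generator (v %% m) in tensor
   factor (block) (v %/ m). *)
Definition blk (s m b a : nat) : {mpoly F[s * m]} :=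
  if (a < m)%N then
    (if insub (b * m + a)%N is Some i then 'X_i else 0)
  else 0.

Definition place (s m c : nat) (q : {mpoly F[2 * m]}) : {mpoly F[s * m]} :=
  q \mPo [tuple blk s m (c + i %/ m) (i %% m) | i < 2 * m].

(* cosimplicial face maps of the cobar construction:
   face 0 = 1 (x) -, face i = Delta on the i-th factor, face (s+1) = - (x) 1 *)
Definition face (m : nat) (cop : nat -> {mpoly F[2 * m]}) (s i : nat)
    (z : {mpoly F[s * m]}) : {mpoly F[s.+1 * m]} :=
  z \mPo [tuple (let b := (v %/ m)%N in let a := (v %% m)%N in
          if (b.+1 < i)%N then blk s.+1 m b a
          else if b.+1 == i then place s.+1 m b (cop a)
          else blk s.+1 m b.+1 a) | v < s * m].

Definition dcob (m : nat) (cop : nat -> {mpoly F[2 * m]}) (s : nat)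
    (z : {mpoly F[s * m]}) : {mpoly F[s.+1 * m]} :=
  \sum_(i < s.+2) (-1) ^+ i *: face m cop s i z.

(* every tensor factor of every monomial is non-constant:
   the normalized cobar complex  (A-bar)^{(x)s} *)
Definition normalized (s m : nat) (z : {mpoly F[s * m]}) : Prop :=
  forall mon, mon \in msupp z -> forall b, (b < s)%N ->
    exists v : 'I_(s * m), ((v %/ m)%N == b) && (0 < mon v)%N.

(* A filtered cobar complex: number of generators, coproduct of the
   generators, normal form map (for quotient algebras), May weight of
   x_a^e, and extra admissibility condition (homogeneity / normal form). *)
Record fcob := FCob {
  gens : nat;
  cop : nat -> {mpoly F[2 * gens]};
  nf : forall s, {mpoly F[s * gens]} -> {mpoly F[s * gens]};
  wtv : nat -> nat -> nat;
  adm : forall s, {mpoly F[s * gens]} -> Prop }.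

Definition dC (C : fcob) (s : nat) (z : {mpoly F[s * gens C]})
  : {mpoly F[s.+1 * gens C]} := nf C s.+1 (dcob (gens C) (cop C) s z).

Definition wtC (C : fcob) (s : nat) (mon : 'X_{1..s * gens C}) : nat :=
  (\sum_(v < s * gens C) wtv C (v %% gens C) (mon v))%N.

Definition Fsub (C : fcob) (s M r : nat) (z : {mpoly F[s * gens C]}) : Prop :=
  forall mon, mon \in msupp z -> (wtC C s mon + r <= M)%N.

Definition cochain (C : fcob) (s : nat) (z : {mpoly F[s * gens C]}) : Prop :=
  normalized s (gens C) z /\ adm C s z.

(* z, y in F_M C^s define the same class in E_1^{s,*,M} = H(F_M/F_{M-1}) *)
Definition sameE1 (C : fcob) (M s : nat) :
    {mpoly F[s * gens C]} -> {mpoly F[s * gens C]} -> Prop :=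
  match s as s0 return {mpoly F[s0 * gens C]} -> {mpoly F[s0 * gens C]} -> Prop
  with
  | 0 => fun z y => Fsub C 0 M 1 (z - y)
  | s'.+1 => fun z y => exists w : {mpoly F[s' * gens C]},
      cochain C s' w /\ Fsub C s' M 0 w /\ Fsub C s'.+1 M 1 (z - y - dC C s' w)
  end.

(* the E_1 class of y (in filtration M, cohomological degree s) survives
   to E_{r}, i.e. d_1, ..., d_{r-1} vanish on it: it has a lift z with
   d z in F_{M-r}.  d_1-cocycle = survives 2; infinite cocycle = survives r
   for all r. *)
Definition survives (C : fcob) (r s M : nat) (y : {mpoly F[s * gens C]}) : Prop :=
  exists z : {mpoly F[s * gens C]},
    cochain C s z /\ Fsub C s M 0 z /\ sameE1 C M s z y /\ Fsub C s.+1 M r (dC C s z).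

Definition d1_cocycle (C : fcob) (s M : nat) (y : {mpoly F[s * gens C]}) :=
  survives C 2 s M y.

Definition infinite_cocycle (C : fcob) (s M : nat) (y : {mpoly F[s * gens C]}) :=
  forall r, survives C r s M y.

Definition E1_zero (C : fcob) (s M : nat) : Prop :=
  forall z : {mpoly F[s * gens C]}, cochain C s z -> Fsub C s M 0 z ->
    Fsub C s.+1 M 1 (dC C s z) -> sameE1 C M s z 0.

(* T(n,k): generator a (a < n) is xi_{k+a}.                           *)
Variables n k : nat.

Definition copT (a : nat) : {mpoly F[2 * n]} :=
  blk 2 n 0 a + blk 2 n 1 a
  + \sum_(k <= r < a.+1) blk 2 n 0 (r - k) * blk 2 n 1 (a - r) ^+ (p ^ r).

(* |xi_i| = 2(p-1)(1 + ... + p^{i-1}) = 2(p^i - 1) *)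
Definition degT (s : nat) (mon : 'X_{1..s * n}) : nat :=
  (\sum_(v < s * n) mon v * (2 * (p ^ (k + v %% n) - 1)))%N.

Definition homogT (t s : nat) (z : {mpoly F[s * n]}) : Prop :=
  forall mon, mon \in msupp z -> degT s mon = t.

Definition wtvT (a e : nat) : nat := ((2 * (k + a) - 1) * digsum p e)%N.

Definition Tcx (t : nat) : fcob :=
  FCob n copT (fun s z => z) wtvT (homogT t).

(* S(n,k) = F_p[t_k, t_{k+1}, ...]/(t_s^{p^n} - t_s).  Its cobar complex is
   the union over N of the cobar complexes of the sub Hopf algebras
   S_N generated by t_k, ..., t_{k+N-1} (N >= n); generator a is t_{k+a}. *)

(* normal form exponent modulo t^{p^n} = t *)
Definition redexp (e : nat) : nat :=
  if e == 0%N then 0%N else (((e.-1) %% (p ^ n).-1).+1)%N.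

Definition redS (m s : nat) (z : {mpoly F[s * m]}) : {mpoly F[s * m]} :=
  \sum_(mon <- msupp z) z@_mon *: 'X_[[multinom redexp (mon i) | i < s * m]].

Definition reducedS (m s : nat) (z : {mpoly F[s * m]}) : Prop :=
  forall mon, mon \in msupp z -> forall i, (mon i < p ^ n)%N.

Definition bS (N c : nat) : {mpoly F[2 * N]} :=
  \sum_(1 <= m < p)
     ('C(p, m) %/ p)%:R * (blk 2 N 0 c ^+ (m * p ^ (n - 1))
                           * blk 2 N 1 c ^+ ((p - m) * p ^ (n - 1))).

Definition copS (N a : nat) : {mpoly F[2 * N]} :=
  blk 2 N 0 a + blk 2 N 1 a
  + \sum_(k <= r < a.+1) blk 2 N 0 (r - k) * blk 2 N 1 (a - r) ^+ (p ^ r)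
  - (if (n <= a)%N then bS N (a - n) else 0).

(* M(t_s^{p^j}), j taken mod n (as t_s^{p^n} = t_s); fuel = s suffices *)
Fixpoint MwS_aux (fuel s j : nat) : nat :=
  match fuel with
  | 0 => (2 * s - 1)%N
  | f.+1 => if (s < n + k)%N then (2 * s - 1)%N
            else maxn (2 * s - 1) (p * MwS_aux f (s - n) ((j + n - 1) %% n) + 1)
  end.
Definition MwS (s j : nat) : nat := MwS_aux s s j.

Definition wtvS (a e : nat) : nat :=
  (\sum_(l < e.+1) digit p l e * MwS (k + a) (l %% n))%N.

Definition Scx (N : nat) : fcob :=
  FCob N (copS N) (redS N) wtvS (reducedS N).

(* Phi : cobar of T -> cobar of S_N, induced by xi_i |-> t_i *)
Definition PhiN (N s : nat) (y : {mpoly F[s * n]}) : {mpoly F[s * N]} :=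
  redS N s (y \mPo [tuple blk s N (v %/ n) (v %% n) | v < s * n]).

(* Elements of the exterior part E[h'_{i,j}] of E_1, given as linear
   combinations of words h'_{i_1,j_1} ... h'_{i_s,j_s}; the word is
   represented in the cobar complex by [xi_{i_1}^{p^{j_1}} | ... ]. *)
Definition word := seq (nat * nat).

Definition repT (s : nat) (g : seq (F * word)) : {mpoly F[s * n]} :=
  \sum_(cw <- g) cw.1 *:
     \prod_(l < s) blk s n l ((nth (0, 0) cw.2 l).1 - k)
                      ^+ (p ^ (nth (0, 0) cw.2 l).2).

Definition SIw (w : word) : nat := (\sum_(ij <- w) ij.1)%N.
(* inner degree of a word divided by 2(p-1):  sum p^j (1 + ... + p^{i-1}) *)
Definition degw (w : word) : nat :=
  (\sum_(ij <- w) p ^ ij.2 * \sum_(u < ij.1) p ^ u)%N.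
Definition word_ok (w : word) : bool :=
  all (fun ij => (k <= ij.1 <= n + k - 1)%N) w.

End Cobar.

(* Main.v *)
Require Import Defs.
From mathcomp Require Import all_boot all_order all_algebra all_field.
From mathcomp Require Import mpoly zify.

(* The associated graded Hopf algebra is primitively generated by the
   truncated generators y = xi_i^(p^j), y^p = 0, so the leading part of the
   cobar differential splits one letter of a word [b_1|...|b_s] of monomials
   without carries, with coefficient a product of binomials prime to p.
   A discrete Morse matching (the one behind Anick's resolution of a truncated
   polynomial algebra) leaves as critical words only concatenations of [y] and
   [y|y^(p-1)], the representatives of h' and b'; on these 2 Sd <= M + s holds,
   hence E_1 vanishes below that line.  For an exterior class with SI = Sd,
   M + s = 2 Sd, so the target of d_r, r >= 2, lies in the vanishing region and
   a lift can be corrected step by step until its coboundary is zero.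

   For S(n,k) the subalgebra on t_k, ..., t_(k+n-1) already suffices.  There the
   coproduct is that of T(n,k), and reduction modulo t^(p^n) = t is a filtered
   chain map, because x^(p^n) = x holds for every x after reduction. *)

(** The numerical core is that digit sums are subadditive, with equality exactly when no carry
    occurs. The May filtration of a letter combines digit sums of its exponents with positive
    coefficients 2i-1, so splitting a monomial keeps the filtration exactly when it is carry-free.
    The mixed coproduct terms xi_r (x) xi_(i-r)^(p^r) have filtration (2r-1)+(2(i-r)-1) = 2i-2, one
    too low. The line is sharp on h': (2i-1)+1 is twice the digit sum i of its degree, while b' has
    p(2i-1)+2, well above 2i. As d_r changes M+s by 1-r, d_1 stays on the line, so its vanishing has
    to be assumed. E_1 is never computed as a tensor product: its classes are given by cochains and
    lifts, so the matching acts on cochains. Coboundaries remove the words of one type, and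
    triangularity excludes the other. Both arguments need a well-founded order on words; in a fixed
    inner degree there are finitely many words, so a bounded integer potential is enough. *)

Set Implicit Arguments.
Unset Strict Implicit.
Unset Printing Implicit Defensive.

Import GRing.Theory.

(** * Base-p digits and carries *)

Section Digits.
Local Open Scope nat_scope.
Variable p : nat.
Hypothesis p_gt1 : 1 < p.

Let p_gt0 : 0 < p. Proof. exact: ltnW. Qed.

Lemma digit0 e : digit p 0 e = e %% p.
Proof. by rewrite /digit expn0 divn1. Qed.

Lemma digitS l e : digit p l.+1 e = digit p l (e %/ p).
Proof. by rewrite /digit expnS divnMA. Qed.

Lemma digit_lt l e : digit p l e < p.
Proof. exact: ltn_pmod. Qed.

Lemma digit_zero l : digit p l 0 = 0.
Proof. by rewrite /digit div0n mod0n. Qed.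

Lemma digit_big l e : e < p ^ l -> digit p l e = 0.
Proof. by move=> h; rewrite /digit divn_small // mod0n. Qed.

Lemma digsum_widen e N : e < p ^ N -> digsum p e = \sum_(l < N) digit p l e.
Proof.
rewrite /digsum -!(big_mkord xpredT (fun l => digit p l e)) => h.
have z a b : e < p ^ a -> \sum_(a <= l < b) digit p l e = 0.
  move=> ha; rewrite big_nat big1 // => l /andP[al _]; apply: digit_big.
  by apply: leq_trans ha _; rewrite leq_exp2l.
have he : e < p ^ e.+1 by apply: ltn_trans (ltn_expl _ p_gt1); exact: ltnSn.
case: (leqP N e.+1) => hN.
  by rewrite (big_cat_nat (n := N)) //= (z N) // addn0.
by rewrite [RHS](big_cat_nat (n := e.+1)) //= ?(z e.+1) ?addn0 // ltnW.
Qed.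

Lemma digsum_rec e : digsum p e = e %% p + digsum p (e %/ p).
Proof.
have he : e < p ^ e.+1 by apply: ltn_trans (ltn_expl _ p_gt1); exact: ltnSn.
have he' : e %/ p < p ^ e by rewrite ltn_divLR // -expnSr.
rewrite (digsum_widen he) (digsum_widen he') big_ord_recl digit0.
by congr (_ + _); apply: eq_bigr => i _; rewrite -digitS.
Qed.

Lemma digsum0 : digsum p 0 = 0.
Proof. by rewrite /digsum big_ord1 digit_zero. Qed.

Lemma digsum_small e : e < p -> digsum p e = e.
Proof. by move=> h; rewrite digsum_rec divn_small // modn_small // digsum0 addn0. Qed.

Lemma digsum_pmul e : digsum p (p * e) = digsum p e.
Proof. by rewrite digsum_rec modnMr mulKn. Qed.

Lemma digsum_expM l e : digsum p (p ^ l * e) = digsum p e.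
Proof. by elim: l => [|l IH]; rewrite ?mul1n // expnS -mulnA digsum_pmul. Qed.

Definition nocarry e f := forall l, digit p l e + digit p l f < p.

Lemma nocarryE e f :
  nocarry e f <-> e %% p + f %% p < p /\ nocarry (e %/ p) (f %/ p).
Proof.
split=> [h|[h0 h] [|l]]; last 2 first.
- by rewrite !digit0.
- by rewrite !digitS; apply: h.
by split=> [|l]; [have := h 0; rewrite !digit0 | have := h l.+1; rewrite !digitS].
Qed.

Lemma divn_nocarry e f : e %% p + f %% p < p -> (e + f) %/ p = e %/ p + f %/ p.
Proof. by move=> h; rewrite divnD // leqNgt h addn0. Qed.

Lemma nocarry_div e f l : nocarry e f -> (e + f) %/ p ^ l = e %/ p ^ l + f %/ p ^ l.
Proof.
elim: l e f => [|l IH] e f; first by rewrite expn0 !divn1.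
by move=> /nocarryE[h0 h]; rewrite expnS !divnMA divn_nocarry // IH.
Qed.

Lemma digit_nocarry e f l : nocarry e f -> digit p l (e + f) = digit p l e + digit p l f.
Proof.
move=> h; rewrite /digit nocarry_div // -modnDm modn_small //.
exact: h.
Qed.

Lemma digsum_nocarry e f : nocarry e f -> digsum p (e + f) = digsum p e + digsum p f.
Proof.
move=> h; have lt_exp a b : a <= b -> a < p ^ b.
  by move=> ab; apply: leq_ltn_trans ab (ltn_expl _ p_gt1).
rewrite !(@digsum_widen _ (e + f)) ?lt_exp ?leq_addr ?leq_addl //.
by rewrite -big_split; apply: eq_bigr => i _; apply: digit_nocarry.
Qed.

(** A carry trades [p] units for one unit a place higher, a loss of [p - 1]. The strict inequality
    lets an induction on [e + f] go on with the carry counted in. *)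
Lemma digsum_carry e f : p <= e %% p + f %% p ->
  digsum p (e + f) + p = e %% p + f %% p + digsum p (e %/ p + f %/ p + 1)
  /\ e %/ p + f %/ p + 1 < e + f.
Proof.
move=> h.
have De := divn_eq e p; have Df := divn_eq f p.
have lee := ltn_pmod e p_gt0; have lef := ltn_pmod f p_gt0.
set a := e %/ p in De *; set b := f %/ p in Df *.
set x := e %% p in De h lee *; set y := f %% p in Df h lef *.
have E : e + f = (a + b + 1) * p + (x + y - p) by lia.
have lt : x + y - p < p by lia.
split; last by nia.
rewrite E digsum_rec modnMDl divnMDl // (divn_small lt) modn_small // addn0.
lia.
Qed.

Lemma digsumD_le e f : digsum p (e + f) <= digsum p e + digsum p f.
Proof.
have [m] := ubnP (e + f); elim: m e f => // m IH e f hm.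
rewrite (digsum_rec e) (digsum_rec f).
case: (ltnP (e %% p + f %% p) p) => h.
  case: (posnP (e + f)) => [/eqP|ef0].
    by rewrite addn_eq0 => /andP[/eqP-> /eqP->]; rewrite digsum0.
  rewrite (digsum_rec (e + f)) -modnDm modn_small // divn_nocarry //.
  have le : e %/ p + f %/ p < m.
    rewrite -divn_nocarry //; apply: leq_trans (_ : e + f <= m) => //.
    exact: ltn_Pdiv.
  by have := IH _ _ le; lia.
have [E lt] := digsum_carry h.
(* The carry is a third summand 1, so the hypothesis is used twice; it adds at most 1 where the
   lowest digits lose [p]. *)
have := IH (e %/ p + f %/ p) 1 ltac:(lia).
have := IH (e %/ p) (f %/ p) ltac:(lia).
rewrite (@digsum_small 1) //; lia.
Qed.

Lemma nocarryP e f : digsum p (e + f) = digsum p e + digsum p f -> nocarry e f.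
Proof.
have [m] := ubnP (e + f); elim: m e f => // m IH e f hm E.
case: (posnP (e + f)) => [/eqP|ef0].
  by rewrite addn_eq0 => /andP[/eqP-> /eqP->] l; rewrite digit_zero.
apply/nocarryE; case: (ltnP (e %% p + f %% p) p) => h.
  split=> //; apply: IH.
    rewrite -divn_nocarry //; apply: leq_trans (_ : e + f <= m) => //.
    exact: ltn_Pdiv.
  move: E; rewrite (digsum_rec e) (digsum_rec f) (digsum_rec (e + f)).
  by rewrite -modnDm modn_small // divn_nocarry //; lia.
have [E' _] := digsum_carry h.
have := digsumD_le (e %/ p + f %/ p) 1; have := digsumD_le (e %/ p) (f %/ p).
move: E; rewrite (digsum_rec e) (digsum_rec f) (@digsum_small 1) //; lia.
Qed.

Lemma digsum_gt0 e : 0 < e -> 0 < digsum p e.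
Proof.
have [m] := ubnP e; elim: m e => // m IH e hm e0.
rewrite digsum_rec addn_gt0; case: posnP => //= h.
apply: IH; first exact: leq_trans (ltn_Pdiv p_gt1 e0) hm.
by rewrite divn_gt0 // dvdn_leq // /dvdn h.
Qed.

Lemma digit_subn e l r : r <= digit p l e ->
  r * p ^ l <= e /\
  forall l', digit p l' (e - r * p ^ l) = digit p l' e - (l' == l) * r.
Proof.
elim: l e => [|l IH] e.
  rewrite digit0 expn0 muln1 => h.
  have De := divn_eq e p; have lee := ltn_pmod e p_gt0.
  have le : e - r = e %/ p * p + (e %% p - r) by rewrite addnBA // -De.
  split; first by rewrite (leq_trans h) // leq_mod.
  have lt : e %% p - r < p by apply: leq_ltn_trans lee; exact: leq_subr.
  case=> [|l']; first by rewrite !digit0 eqxx mul1n le modnMDl modn_small.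
  by rewrite !digitS le divnMDl // (divn_small lt) addn0 mul0n subn0.
rewrite digitS => /IH[le E].
have De := divn_eq e p; have lee := ltn_pmod e p_gt0.
have lep : r * p ^ l.+1 <= e.
  rewrite expnSr mulnA; apply: leq_trans (leq_divM e p).
  by rewrite leq_mul2r le orbT.
split=> //.
have D : e - r * p ^ l.+1 = (e %/ p - r * p ^ l) * p + e %% p.
  by rewrite mulnBl expnSr mulnA addnBAC -?De // leq_mul2r le orbT.
case=> [|l']; first by rewrite !digit0 D modnMDl modn_mod mul0n subn0.
by rewrite !digitS D divnMDl // (divn_small lee) addn0 E eqSS.
Qed.

Lemma digit_mulexp r l l' : r < p -> digit p l' (r * p ^ l) = (l' == l) * r.
Proof.
move=> rp; elim: l l' => [|l IH] [|l'].
- by rewrite digit0 expn0 muln1 modn_small ?mul1n.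
- by rewrite digitS expn0 muln1 divn_small // digit_zero.
- by rewrite digit0 expnSr mulnA modnMl.
by rewrite digitS expnSr mulnA mulnK // IH eqSS.
Qed.

(** The inner degree of xi_i is [2(p-1) repunit i]. Its base-p digits are i ones, so Sd of h'_{i,j}
    is the index i. *)
Definition repunit i := \sum_(u < i) p ^ u.

Lemma repunitS i : repunit i.+1 = 1 + p * repunit i.
Proof.
rewrite /repunit big_ord_recl big_distrr; congr (_ + _).
by apply: eq_bigr => u _; exact: expnS.
Qed.

Lemma digsum_repunit i : digsum p (repunit i) = i.
Proof.
elim: i => [|i IH]; first by rewrite /repunit big_ord0 digsum0.
have E : (1 + p * repunit i) = repunit i * p + 1 by rewrite addnC mulnC.
rewrite repunitS digsum_rec E modnMDl divnMDl // (divn_small p_gt1) addn0 IH.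
by rewrite modn_small.
Qed.

Lemma repunit_pred i : (p - 1) * repunit i = p ^ i - 1.
Proof. by rewrite !subn1 predn_exp. Qed.

Lemma logn_fact_exp N e : prime p -> e <= N -> logn p e`! = \sum_(1 <= l < N.+1) e %/ p ^ l.
Proof.
move=> pr h; rewrite logn_fact // [RHS](big_cat_nat (n := e.+1)) //=.
rewrite [X in _ + X]big_nat [X in _ + X]big1 ?addn0 // => l /andP[el _].
by rewrite divn_small // (ltn_trans el) // ltn_expl.
Qed.

(** Half of Kummer's theorem, via Legendre's formula: without carries all quotients by powers of [p]
    are additive, so [(e + f)!] and the product of [e!] and [f!] have the same p-adic valuation. *)
Lemma nocarry_bin e f : prime p -> nocarry e f -> ~~ (p %| 'C(e + f, e)).
Proof.
move=> pr h; have b0 : 0 < 'C(e + f, e) by rewrite bin_gt0 leq_addr.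
have := bin_fact (leq_addr f e); rewrite addKn => /(congr1 (logn p)).
rewrite !lognM ?muln_gt0 ?fact_gt0 //.
rewrite !(@logn_fact_exp (e + f)) ?leq_addr ?leq_addl // -big_split /=.
under [in RHS]eq_bigr do rewrite nocarry_div //.
move=> /eqP; rewrite -[X in _ == X]add0n eqn_add2r lognE pr b0 /=.
by case: (p %| _).
Qed.

End Digits.

(** * The matching on words *)

Section Letters.
Local Open Scope nat_scope.
Variables p n : nat.
Hypothesis p_gt2 : 2 < p.
Hypothesis n_gt0 : 0 < n.

Let p_gt1 : 1 < p. Proof. exact: ltnW. Qed.
Let p_gt0 : 0 < p. Proof. exact: ltnW. Qed.

Local Notation letter := 'X_{1..n}.
Implicit Types (b c d : letter) (y : nat).

(* The truncated generator xi_(k+a)^(p^l), a < n, is coded by y = l * n + a. *)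
Definition cnt b y := digit p (y %/ n) (nth 0 b (y %% n)).
Definition pw r y : letter := [multinom ((i : nat) == y %% n) * (r * p ^ (y %/ n)) | i < n].
Definition legal b c := forall i, nocarry p (b i) (c i).

Definition gix y : 'I_n := Ordinal (ltn_pmod y n_gt0).

Lemma cntE b y : cnt b y = digit p (y %/ n) (b (gix y)).
Proof. by rewrite /cnt (mnm_nth 0). Qed.

Lemma cnt_ord b l (i : 'I_n) : cnt b (l * n + i) = digit p l (b i).
Proof.
rewrite cntE divnMDl // divn_small // addn0; congr (digit _ _ (b _)).
by apply: val_inj; rewrite /= modnMDl modn_small.
Qed.

Lemma cnt0 y : cnt 0%MM y = 0.
Proof. by rewrite cntE mnm0E digit_zero. Qed.

Lemma cnt_lt b y : cnt b y < p.
Proof. exact: digit_lt. Qed.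

Lemma legalP b c : legal b c <-> forall y, cnt b y + cnt c y < p.
Proof.
split=> [h y|h i l]; first by rewrite !cntE; apply: h.
by have := h (l * n + i); rewrite !cnt_ord.
Qed.

Lemma cntD b c y : legal b c -> cnt (b + c)%MM y = cnt b y + cnt c y.
Proof. by move=> h; rewrite !cntE mnmDE digit_nocarry. Qed.

Lemma cnt_pw r y y' : r < p -> cnt (pw r y) y' = (y' == y) * r.
Proof.
move=> rp; rewrite cntE mnmE /=.
have [E|N] := altP (_ =P y).
  by rewrite E eqxx mul1n digit_mulexp // eqxx.
have [Em|Nm] := altP (y' %% n =P y %% n); last by rewrite mul0n digit_zero.
rewrite mul1n digit_mulexp //; case: eqP => // Ed.
by case/eqP: N; rewrite (divn_eq y' n) (divn_eq y n) Ed Em.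
Qed.

Lemma cnt_subpw b y r : r <= cnt b y ->
  (pw r y + (b - pw r y))%MM = b /\
  forall y', cnt (b - pw r y)%MM y' = cnt b y' - (y' == y) * r.
Proof.
rewrite cntE => h; have [le E] := digit_subn p_gt1 h.
split=> [|y'].
  rewrite addmC submK //; apply/mnm_lepP => i; rewrite mnmE.
  case: eqP => [Ei|_]; last by rewrite mul0n.
  rewrite mul1n; apply: leq_trans le _.
  by apply: eq_leq; congr (b _); apply: val_inj.
rewrite !cntE mnmBE mnmE /=.
have [Em|Nm] := altP (y' %% n =P y %% n); last first.
  rewrite mul0n subn0; case: eqP => [Ey|]; last by rewrite mul0n subn0.
  by rewrite Ey eqxx in Nm.
have Eg : gix y' = gix y by apply: val_inj.
rewrite mul1n Eg E; congr (_ - _ * _).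
suff -> : (y' %/ n == y %/ n) = (y' == y) by [].
by apply/eqP/eqP => [Ed|->//]; rewrite (divn_eq y' n) (divn_eq y n) Ed Em.
Qed.

(** Gives the search range of [mn]: the place of a nonzero digit is at most the exponent, hence at
    most the degree of the letter. *)
Lemma cnt_ex b : b != 0%MM -> exists2 y, 0 < cnt b y & y < n * (mdeg b).+1.
Proof.
move=> b0; have [i bi] : exists i, 0 < b i.
  apply/existsP; apply: contraNT b0; rewrite negb_exists => /forallP h.
  by apply/eqP/mnmP => i; rewrite mnm0E; have := h i; rewrite -eqn0Ngt => /eqP.
have := digsum_gt0 p_gt1 bi; rewrite /digsum lt0n sum_nat_eq0 negb_forall.
case/existsP=> l; rewrite /= -lt0n => hl.
exists (l * n + i); first by rewrite cnt_ord.
have : l < (mdeg b).+1 by apply: leq_trans (ltn_ord l) _; rewrite ltnS mdegE (bigD1 i) //= leq_addr.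
by have := ltn_ord i; nia.
Qed.

Definition mn b := find (fun y => 0 < cnt b y) (iota 0 (n * (mdeg b).+1)).

Lemma mn_cnt b : b != 0%MM -> 0 < cnt b (mn b).
Proof.
move=> /cnt_ex[y hy ly].
have hs : has (fun y => 0 < cnt b y) (iota 0 (n * (mdeg b).+1)).
  by apply/hasP; exists y => //; rewrite mem_iota.
have := nth_find 0 hs; rewrite nth_iota //.
by move: hs; rewrite has_find size_iota.
Qed.

Lemma mn_min b y : y < mn b -> cnt b y = 0.
Proof.
move=> h; have := before_find 0 h; rewrite nth_iota; last first.
  by apply: leq_trans h _; rewrite -[leqRHS](size_iota 0) find_size.
by rewrite add0n => /negbT; rewrite -eqn0Ngt => /eqP.
Qed.

Lemma mn_eq b y : 0 < cnt b y -> (forall y', y' < y -> cnt b y' = 0) -> mn b = y.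
Proof.
move=> hy hm; have b0 : b != 0%MM by apply: contraTneq hy => ->; rewrite cnt0.
case: (ltngtP (mn b) y) => // h; first by have := mn_cnt b0; rewrite hm.
by move: hy; rewrite mn_min.
Qed.

Lemma pw_neq0 r y : 0 < r < p -> pw r y != 0%MM.
Proof.
move=> /andP[r0 rp]; apply: contraTneq (r0) => E.
by have := cnt_pw y y rp; rewrite E cnt0 eqxx mul1n => <-.
Qed.

Lemma mn_pw r y : 0 < r < p -> mn (pw r y) = y.
Proof.
move=> /andP[r0 rp]; apply: mn_eq => [|y' h]; rewrite cnt_pw // ?eqxx ?mul1n //.
by rewrite ltn_eqF.
Qed.

(* What was read last: [Some (true, y)] the single generator y, [Some (false, y)]
   the letter y^(p-1), [None] nothing. *)
Definition state := option (bool * nat).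
Implicit Types st : state.

(** The chain condition of Anick's resolution. After a single [y0] only smaller generators pass, so
    [[y0|y0]] is not critical (h' squares to zero); [y0^(p-1)] is let in separately by [ispow], and
    after it [y0] itself may start again. *)
Definition thr st y := if st is Some (s, y0) then y < y0 + ~~ s else true.
Definition ispow st b :=
  if st is Some (true, y) then (cnt b y == p - 1) && (mn b == y) else false.
Definition isA st b := thr st (mn b) || ispow st b.
Definition base st b := pw (if ispow st b then p - 1 else 1) (mn b).
Definition nxt st b : state := Some (~~ ispow st b, mn b).

Lemma base_exp st b : 0 < (if ispow st b then p - 1 else 1) < p.
Proof. by case: ifP => _; lia. Qed.

Lemma ispow_cnt st b : ispow st b -> cnt b (mn b) = p - 1.
Proof. by case: st => [[[] y]|] //= /andP[/eqP h /eqP ->]. Qed.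

Lemma base_le_cnt st b : b != 0%MM -> (if ispow st b then p - 1 else 1) <= cnt b (mn b).
Proof.
by move=> b0; case: ifP => [/ispow_cnt->//|_]; apply: mn_cnt.
Qed.

(** A letter is read only through its least generator and, after a single generator, through whether
    that exponent is [p - 1]; [base] is read the same way. Here [p > 2] tells [y] from [y^(p-1)]. *)
Lemma isA_base st b : b != 0%MM -> isA st b ->
  [/\ ispow st (base st b) = ispow st b, mn (base st b) = mn b,
      isA st (base st b), base st (base st b) = base st b &
      nxt st (base st b) = nxt st b].
Proof.
move=> b0 hA.
have Em : mn (base st b) = mn b by rewrite mn_pw // base_exp.
have Ep : ispow st (base st b) = ispow st b.
  case: st hA Em => [[[] y]|] //= hA Em.
  have [Ey|Ny] := altP (mn b =P y); last by rewrite Em (negbTE Ny) !andbF.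
  rewrite Em Ey eqxx !andbT /base /= Ey eqxx andbT.
  by case: ifP => hp; rewrite cnt_pw ?eqxx ?mul1n //; lia.
split=> //; first by rewrite /isA Ep Em.
  by rewrite {1}/base Ep Em.
by rewrite /nxt Ep Em.
Qed.

(** Why the rest is unaccepted: after [y^(p-1)] nothing of [y] is left, so its least generator is
    strictly larger; after a single [y] fewer than [p - 1] copies of [y] are left, since digits stay
    below [p]. *)
Lemma split_base st b : b != 0%MM -> isA st b ->
  [/\ (base st b + (b - base st b))%MM = b, legal (base st b) (b - base st b)%MM &
      b != base st b -> (b - base st b)%MM != 0%MM /\ ~~ isA (nxt st b) (b - base st b)%MM].
Proof.
move=> b0 hA; have [E hc] := cnt_subpw (base_le_cnt st b0).
have hr := base_exp st b; case/andP: (hr) => r0 rp.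
split=> //.
  apply/legalP => y; rewrite hc cnt_pw //; case: eqP => [->|_]; last first.
    by rewrite !mul0n add0n subn0 cnt_lt.
  by rewrite !mul1n subnKC ?base_le_cnt // cnt_lt.
move=> bb; have d0 : (b - base st b)%MM != 0%MM.
  by apply: contraNneq bb => d0; rewrite -{1}E d0 addm0.
split=> //; set d := (b - _)%MM in d0 *.
have hcd y : cnt d y = cnt b y - (y == mn b) * (if ispow st b then p - 1 else 1).
  exact: hc.
have md : mn b <= mn d.
  rewrite leqNgt; apply/negP => h; have := mn_cnt d0.
  by rewrite hcd (mn_min h).
rewrite /isA /nxt negb_or /= negbK; case: ifP (hcd) => hp hcd' /=.
  rewrite andbT addn1 ltnS -ltnNge ltn_neqAle md andbT; apply/eqP => Emd.
  have := mn_cnt d0; rewrite hcd' -Emd eqxx mul1n.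
  by rewrite (ispow_cnt hp) subnn.
rewrite addn0 -leqNgt md /= negb_and; apply/orP; left.
rewrite hcd' eqxx mul1n; have := cnt_lt b (mn b); have := mn_cnt b0; lia.
Qed.

(** Converse of splitting off the base. The least generator of [d] is not below that of [c], and a
    carry would need [y^(p-1)] after [y] or [y] after [y^(p-1)], both of which are accepted. *)
Lemma base_merge st c d : c != 0%MM -> d != 0%MM -> isA st c -> c = base st c ->
  ~~ isA (nxt st c) d ->
  [/\ legal c d, isA st (c + d)%MM & base st (c + d)%MM = c].
Proof.
move=> c0 d0 hA Ec.
have hr := base_exp st c; case/andP: (hr) => r0 rp.
have hc y : cnt c y = (y == mn c) * (if ispow st c then p - 1 else 1).
  by rewrite {1}Ec cnt_pw.
rewrite /isA negb_or /= negbK => /andP[h1 h2].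
have md : mn c <= mn d by move: h1; case: ispow => /=; lia.
have L : legal c d.
  apply/legalP => y; rewrite hc; case: eqP => [->|_]; last by rewrite cnt_lt.
  rewrite mul1n; case: (ispow st c) h1 h2 => /=.
    rewrite addn1 ltnS -ltnNge => h _; rewrite (mn_min h); lia.
  rewrite addn0 -leqNgt => _ /=; rewrite negb_and => /orP[] h.
    have := cnt_lt d (mn c); move: h; lia.
  rewrite mn_min; first by lia.
  by rewrite ltn_neqAle eq_sym h.
have Em : mn (c + d)%MM = mn c.
  apply: mn_eq => [|y hy]; rewrite cntD //.
    by rewrite ltn_addr // mn_cnt.
  by rewrite mn_min // mn_min // (leq_trans hy).
have Ep : ispow st (c + d)%MM = ispow st c.
  case: st hA Ec hr r0 rp hc h1 h2 => [[[] y]|] //= hA Ec hr r0 rp hc h1 h2.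
  rewrite Em cntD // hc; move: hA; rewrite /isA /= addn0.
  case: (ltngtP (mn c) y) => [||E]; rewrite ?andbF //= ?andbT => hp.
  move: h1; rewrite hp E eqxx /= addn1 ltnS -ltnNge => h.
  by rewrite mn_min // addn0.
split=> //; last by rewrite {2}Ec /base Ep Em.
by rewrite Ep Em; move: hA; rewrite /isA.
Qed.

(** * Inversions between letters *)

Section Cross.
Variable K : nat.

(** Inversions with multiplicity: a generator of the earlier letter [b] larger than one of the later
    letter [c]. The cutoff [K] makes the sum finite. *)
Definition cross b c := \sum_(y < K) \sum_(y' < y) cnt b y * cnt c y'.

Lemma crossDr b c d : legal c d -> cross b (c + d)%MM = cross b c + cross b d.
Proof.
move=> L; rewrite /cross -big_split; apply: eq_bigr => y _.
by rewrite -big_split; apply: eq_bigr => y' _; rewrite cntD // mulnDr.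
Qed.

Lemma crossDl b c d : legal c d -> cross (c + d)%MM b = cross c b + cross d b.
Proof.
move=> L; rewrite /cross -big_split; apply: eq_bigr => y _.
by rewrite -big_split; apply: eq_bigr => y' _; rewrite cntD // mulnDl.
Qed.

Lemma cross_base st b : b != 0%MM -> isA st b -> cross (base st b) (b - base st b)%MM = 0.
Proof.
move=> b0 hA; apply: big1 => y _; apply: big1 => y' _.
have [_ hc] := cnt_subpw (base_le_cnt st b0).
rewrite hc cnt_pw; last by case/andP: (base_exp st b).
case: eqP => // Ey; rewrite mul1n (@mn_min b) ?sub0n ?muln0 //.
by rewrite -Ey.
Qed.

(** Acceptance puts the least generator of [d] at or below that of [c]; if they were equal, the
    product would carry. *)
Lemma cross_gt0 st c d : c != 0%MM -> d != 0%MM -> isA st c -> c = base st c ->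
  legal c d -> isA (nxt st c) d -> mn c < K -> 0 < cross c d.
Proof.
move=> c0 d0 hA Ec /legalP L hd hK.
have hr := base_exp st c; case/andP: (hr) => r0 rp.
have hc y : cnt c y = (y == mn c) * (if ispow st c then p - 1 else 1).
  by rewrite {1}Ec cnt_pw.
have lt : mn d < mn c.
  move: hd; rewrite /isA /nxt /= negbK.
  have := L (mn c); rewrite hc eqxx mul1n; case: (ispow st c) => /=.
    rewrite orbF addn1 ltnS [_ <= mn c]leq_eqVlt => hl /orP[/eqP E|//].
    by move: hl; rewrite -E; have := mn_cnt d0; lia.
  rewrite addn0 => hl /orP[//|/andP[/eqP E _]].
  by move: hl; rewrite E; lia.
rewrite /cross (bigD1 (Ordinal hK)) //= (bigD1 (Ordinal lt)) //=.
by rewrite !addn_gt0 muln_gt0 !mn_cnt.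
Qed.

(** * Words, the matching and its acyclicity *)

Local Notation word := (seq letter).
Implicit Types (u v w : word).

(* A letter equal to its base is accepted and the reading goes on.  The first
   letter that is not accepted is either split ([Some true]; [mu] splits its base
   off) or merged with its predecessor ([Some false]; [nu] merges); [None] is a
   critical word. *)
Fixpoint typ st w : option bool :=
  if w is b :: w' then
    if isA st b then
      if b == base st b then typ (nxt st b) w' else Some true
    else Some false
  else None.

Fixpoint mu st w : word :=
  if w is b :: w' then
    if b == base st b then b :: mu (nxt st b) w'
    else base st b :: (b - base st b)%MM :: w'
  else [::].

Fixpoint nu st w : word :=
  if w is b :: w' then
    if w' is c :: w'' then
      if isA (nxt st b) c then b :: nu (nxt st b) w' else (b + c)%MM :: w''
    else w
  else w.

Inductive splits : word -> word -> Prop :=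
| SplitHere c d w : c != 0%MM -> d != 0%MM -> legal c d ->
    splits ((c + d)%MM :: w) [:: c, d & w]
| SplitNext b u v : splits u v -> splits (b :: u) (b :: v).

Definition nz : pred word := all (fun b => b != 0%MM).

Fixpoint winv w := if w is b :: w' then \sum_(c <- w') cross b c + winv w' else 0.
(** A letter at position i, counted from 0, contributes i times its degree; this breaks ties between
    words with equally many inversions. *)
Fixpoint moment w := if w is b :: w' then \sum_(c <- w') mdeg c + moment w' else 0.

Lemma splits_sumcross u v b : splits u v ->
  \sum_(c <- u) cross b c = \sum_(c <- v) cross b c.
Proof.
elim=> [c d w _ _ L|b' u' v' _ IH]; rewrite !big_cons.
  by rewrite crossDr // addnA.
by rewrite IH.
Qed.

Lemma splits_summdeg u v : splits u v ->
  \sum_(c <- u) mdeg c = \sum_(c <- v) mdeg c.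
Proof.
elim=> [c d w _ _ L|b' u' v' _ IH]; rewrite !big_cons.
  by rewrite mdegD addnA.
by rewrite IH.
Qed.

Lemma sumcross_legal w c d : legal c d ->
  \sum_(b <- w) cross (c + d)%MM b =
  \sum_(b <- w) cross c b + \sum_(b <- w) cross d b.
Proof. by move=> L; rewrite -big_split; apply: eq_bigr => b _; rewrite crossDl. Qed.

Lemma splits_winv u v : splits u v -> winv u <= winv v.
Proof.
elim=> [c d w _ _ L|b' u' v' h IH] /=.
  by rewrite big_cons sumcross_legal //; lia.
by rewrite (splits_sumcross _ h) leq_add2l.
Qed.

Lemma splits_nz u v : splits u v -> nz u = nz v.
Proof.
elim=> [c d w c0 d0 _|b' u' v' h IH] /=; last by rewrite IH.
by rewrite c0 d0 mnmD_eq0 (negbTE c0).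
Qed.

Lemma splits_size u v : splits u v -> size v = (size u).+1.
Proof. by elim=> [//|b' u' v' h /= ->]. Qed.

Lemma mu_splits st w : nz w -> typ st w = Some true -> splits w (mu st w).
Proof.
elim: w st => // b w IH st /= /andP[b0 nw].
case: ifP => // hA; case: eqP => [E|/eqP N].
  by move=> h; apply: SplitNext; apply: IH.
move=> _; have [E L /(_ N)[d0 _]] := split_base b0 hA.
rewrite -{1}E; apply: SplitHere => //.
by rewrite pw_neq0 // base_exp.
Qed.

(** The part split off to the left is a power of the least generator, which creates no inversion
    ([cross_base]). *)
Lemma mu_winv st w : nz w -> typ st w = Some true -> winv (mu st w) = winv w.
Proof.
elim: w st => // b w IH st /= /andP[b0 nw].
case: ifP => // hA; case: eqP => [E|/eqP N] h /=.
  by rewrite IH // (splits_sumcross _ (mu_splits nw h)).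
have [E L _] := split_base b0 hA.
rewrite big_cons cross_base // -[in RHS]E sumcross_legal //; lia.
Qed.

Lemma mu_head st w : nz w -> typ st w = Some true ->
  if mu st w is b :: _ then isA st b else false.
Proof.
case: w => // b w /= /andP[b0 nw].
case: ifP => // hA; case: eqP => [E|/eqP N] h //=.
by have [] := isA_base b0 hA.
Qed.

(** At the first unaccepted letter [base_merge] applies: the merged letter is accepted and its base
    is its left part, so reading stops there with [Some true] and [mu] undoes the merge. *)
Lemma nu_spec st b w : nz (b :: w) -> isA st b -> b = base st b ->
  typ (nxt st b) w = Some false ->
  [/\ typ st (nu st (b :: w)) = Some true, mu st (nu st (b :: w)) = b :: w
    & nz (nu st (b :: w))].
Proof.
elim: w b st => // c w IH b st /andP[b0 nw] hA Eb.
have c0 : c != 0%MM by case/andP: nw.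
move: IH; rewrite /=; case: ifP => hc IH.
  case: eqP => [Ec|//] h.
  have [h1 h2 h3] := IH c _ nw hc Ec h.
  rewrite /= hA -Eb eqxx h1 h2 b0 h3; by split.
move=> _; have [L hbc Ebc] := base_merge b0 c0 hA Eb (negbT hc).
rewrite /= hbc Ebc mnmD_eq0 negb_and b0.
have -> : ((b + c)%MM == b) = false.
  by rewrite -{2}[b]addm0 eqm_add2l (negbTE c0).
split=> //; last by case/andP: nw.
by rewrite addmC addmK.
Qed.

(** In the initial state every letter is accepted, so the first unaccepted letter has a predecessor
    to merge with. *)
Lemma nu_spec0 w : nz w -> typ None w = Some false ->
  [/\ typ None (nu None w) = Some true, mu None (nu None w) = w & nz (nu None w)].
Proof.
case: w => // b w nw /=; case: eqP => // Eb h.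
exact: nu_spec.
Qed.

Definition bounded b := forall y, K <= y -> cnt b y = 0.

Lemma bounded_mn b : b != 0%MM -> bounded b -> mn b < K.
Proof.
by move=> b0 h; rewrite ltnNge; apply/negP => /h E; have := mn_cnt b0; rewrite E.
Qed.

(* Splitting a letter never decreases the number of inversions; if it stays the
   same, passing from u to u' moves part of a letter one place to the left. *)
Lemma acyclic st u v u' : splits u v -> v = mu st u' ->
  typ st u = Some true -> typ st u' = Some true -> nz u -> nz u' ->
  (forall b, b \in u -> bounded b) ->
  [\/ u = u', winv u < winv u' | winv u = winv u' /\ moment u' < moment u].
Proof.
move=> h; elim: h st u' => [c d w c0 d0 L|b u1 v1 h IH] st [//|b' w'] /= Ev;
  move: Ev; case: eqP => [Eb'|/eqP Nb'] [].
(* [u] is split in its first letter and [u'] further right. Both [c] and [d] are accepted when read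
   in turn, so [cross c d > 0], and [u] lacks these inversions. *)
- move=> Ec Ew; subst b'; move: (Eb') => Ec.
  case: ifP => // hcd _; case: ifP => // hA Tw' _ /andP[_ nw'] bnd.
  constructor 2; have := mu_head nw' Tw'; rewrite -Ew => hd.
  have bc : bounded c.
    move=> y hy; have := bnd _ (mem_head _ _) y hy; rewrite cntD //.
    by move=> /eqP; rewrite addn_eq0 => /andP[/eqP].
  have := cross_gt0 c0 d0 hA Ec L hd (bounded_mn c0 bc).
  rewrite -(mu_winv nw' Tw') -Ew /= sumcross_legal //.
  rewrite (splits_sumcross _ (mu_splits nw' Tw')) -Ew big_cons; lia.
- move=> -> -> -> _; case: ifP => // hA _ _ /andP[b0 _] _; constructor 1.
  by have [-> _ _] := split_base b0 hA.
- move=> Ec Ew; subst b'; move: (Eb') => Ec.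
  case: ifP => // hA; rewrite -Ec eqxx => Tu Tw' /andP[_ nu1] /andP[_ nw'] bnd.
  have S' := mu_splits nw' Tw'; rewrite -Ew in S'.
  have bnd' b0 : b0 \in u1 -> bounded b0.
    by move=> hb; apply: bnd; rewrite inE hb orbT.
  have E1 := splits_sumcross b h; have E2 := splits_sumcross b S'.
  have E3 := splits_summdeg h; have E4 := splits_summdeg S'.
  case: (IH _ _ Ew Tu Tw' nu1 nw' bnd') => [->|lt|[eq lt]].
  + by constructor 1.
  + by constructor 2; rewrite E1 -E2 ltn_add2l.
  by constructor 3; rewrite E1 E3 -E2 -E4 eq ltn_add2l.
move=> Eb Ev1 Tu; case: ifP => // hA' _ nu0 /andP[b'0 nw'] bnd.
have [Ep Em EA Ebb En] := isA_base b'0 hA'.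
have [E L /(_ Nb')[d0 nA]] := split_base b'0 hA'.
have Tb' : typ st (b' :: w') = Some true by rewrite /= hA' (negbTE Nb').
have nb' : nz (b' :: w') by rewrite /= b'0.
have Ei := mu_winv nb' Tb'.
move: Tu; rewrite Eb EA Ebb eqxx En => Tu.
have hS : splits (b :: u1) (b :: v1) := SplitNext b h.
have Emu : mu st (b' :: w') = b :: v1 by rewrite /= (negbTE Nb') Eb Ev1.
have le := splits_winv hS; rewrite -Emu Ei in le.
suff lt : moment (b' :: w') < moment (b :: u1).
  rewrite /= Eb in le lt *; case: ltngtP le => // hl _.
    by constructor 2.
  by constructor 3.
rewrite /= in Tu *.
(* [u'] is split in its first letter and [u] later. The rest of [b'] is unaccepted, so [u1] would
   have type [Some false] unless its own first letter is the split one. Hence [u] starts with [b],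
   [d' + e] and [u'] with [b + d'], [e]. *)
have [d' [e [w'' [Eu Ew0]]]] : exists d' e w'', [/\ u1 = (d' + e)%MM :: w'',
     v1 = [:: d', e & w''] & true].
  case: h Ev1 Tu {IH hS nu0 bnd le Emu} => [c d w c0 d1 Lcd|b2 u2 v2 h2] [Ed Ew'].
    by move=> _; exists c, d, w.
  by rewrite /= Ed (negbTE nA).
move=> _; move: Ev1; rewrite Ew0 Eu => -[Ed Ew]; rewrite -Ew /= !big_cons mdegD.
have d'0 : d' != 0%MM by rewrite Ed.
by rewrite ltn_add2r -addnA -[ltnLHS]add0n ltn_add2r lt0n mdeg_eq0.
Qed.

End Cross.
End Letters.

(** * Critical words *)

Section Critical.
Local Open Scope nat_scope.
Variables p n k : nat.
Hypothesis p_gt2 : 2 < p.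
Hypothesis n_gt0 : 0 < n.
Hypothesis k_gt0 : 0 < k.

Let p_gt1 : 1 < p. Proof. exact: ltnW. Qed.
Let p_gt0 : 0 < p. Proof. exact: ltnW. Qed.

Definition lwt (b : 'X_{1..n}) := \sum_(a < n) (2 * (k + a) - 1) * digsum p (b a).
Definition ldeg (b : 'X_{1..n}) := \sum_(a < n) b a * repunit p (k + a).

Lemma ldegD b c : ldeg (b + c)%MM = ldeg b + ldeg c.
Proof.
by rewrite /ldeg -big_split; apply: eq_bigr => a _; rewrite mnmDE mulnDl.
Qed.

Lemma ldeg0 : ldeg 0%MM = 0.
Proof. by apply: big1 => a _; rewrite mnm0E. Qed.

Lemma lwt0 : lwt 0%MM = 0.
Proof. by apply: big1 => a _; rewrite mnm0E digsum0 muln0. Qed.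

(** Digit sums are subadditive and the coefficients [2 * (k + a) - 1] are positive, so equality of
    the totals forces equality, hence absence of carries, in every exponent. *)
Lemma lwt_legal b c : legal p b c <-> lwt (b + c)%MM = lwt b + lwt c.
Proof.
rewrite /lwt -big_split; split=> [h|E i].
  by apply: eq_bigr => a _; rewrite mnmDE /= -mulnDr digsum_nocarry.
apply: nocarryP => //; apply/eqP.
have le (a : 'I_n) : true -> (2 * (k + a) - 1) * digsum p ((b + c)%MM a) <=
    (2 * (k + a) - 1) * digsum p (b a) + (2 * (k + a) - 1) * digsum p (c a)
    ?= iff (digsum p (b a + c a) == digsum p (b a) + digsum p (c a)).
  move=> _; split; first by rewrite mnmDE /= -mulnDr leq_mul2l digsumD_le ?orbT.
  by rewrite mnmDE /= -mulnDr eqn_pmul2l //; lia.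
have [_] := leqif_sum le; rewrite E eqxx => /esym/forall_inP.
exact.
Qed.

Lemma digsum_mulexp r l : r < p -> digsum p (r * p ^ l) = r.
Proof. by move=> h; rewrite mulnC digsum_expM // digsum_small. Qed.

Lemma lwt_pw r y : r < p -> lwt (pw p n r y) = (2 * (k + y %% n) - 1) * r.
Proof.
move=> rp; rewrite /lwt (bigD1 (gix n_gt0 y)) //= big1 ?addn0 => [|a /eqP ha].
  by rewrite mnmE /= eqxx mul1n digsum_mulexp.
rewrite mnmE; case: eqP => [E|_]; last by rewrite mul0n digsum0 muln0.
by case: ha; apply: val_inj.
Qed.

Lemma ldeg_pw r y : ldeg (pw p n r y) = r * (p ^ (y %/ n) * repunit p (k + y %% n)).
Proof.
rewrite /ldeg (bigD1 (gix n_gt0 y)) //= big1 ?addn0 => [|a /eqP ha].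
  by rewrite mnmE /= eqxx mul1n mulnA.
rewrite mnmE; case: eqP => [E|_]; last by rewrite mul0n.
by case: ha; apply: val_inj.
Qed.

(* A letter y just read may still be absorbed by a following y^(p-1), so its
   own contribution is kept pending. *)
Definition pend (st : state) := if st is Some (true, y) then pw p n 1 y else 0%MM.
Definition pendn (st : state) : nat := if st is Some (true, y) then 1 else 0.

Lemma pend_bound st : 2 * digsum p (ldeg (pend st)) <= lwt (pend st) + pendn st.
Proof.
have z : 2 * digsum p (ldeg 0%MM) <= lwt 0%MM + 0.
  by rewrite ldeg0 digsum0.
case: st => [[[] y]|] //=; rewrite ldeg_pw lwt_pw // mul1n.
rewrite digsum_expM // digsum_repunit //; lia.
Qed.

(** A single generator of index i adds at most i to the digit sum and exactly 2i to weight plus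
    length. A pair [[y|y^(p-1)]] has [p] times the degree of [y], again of digit sum i, against
    weight plus length p(2i-1)+2. *)
Lemma critical_bound st w : nz w -> typ p st w = None ->
  2 * digsum p (\sum_(b <- w) ldeg b + ldeg (pend st)) <=
  \sum_(b <- w) lwt b + size w + (lwt (pend st) + pendn st).
Proof.
elim: w st => [|b w IH] st; first by rewrite !big_nil => _ _; exact: pend_bound.
move=> /= /andP[b0 nw]; case: ifP => // hA; case: eqP => // Eb h.
have := IH _ nw h; rewrite !big_cons /nxt; case hp: (ispow p st b) => /=.
  have := Eb; rewrite /base hp; case: st hp hA {h Eb} => [[[] y]|] //=.
  move=> /andP[_ /eqP ->] _ ->; rewrite !ldeg_pw !lwt_pw ?mul1n //; last by lia.
  rewrite ldeg0 lwt0 !addn0; set D := \sum_(j <- w) _; set W := \sum_(j <- w) _.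
  set q := p ^ _ * _; have -> : (p - 1) * q + D + q = D + p * q.
    by rewrite mulnBl mul1n addnAC subnK 1?addnC // leq_pmull.
  have := digsumD_le p_gt1 D (p * q).
  rewrite digsum_pmul // digsum_expM // digsum_repunit //.
  have : 2 * (k + y %% n) = (2 * (k + y %% n) - 1) + 1 by lia.
  move: (2 * (k + y %% n) - 1) => m; move: (k + _) => i; move: (digsum p D).
  move: (digsum p _) => ? ?; have := leq0n (m * (p - 1)); move: (m * (p - 1)).
  by move=> *; lia.
have Ebp : b = pw p n 1 (mn p b) by rewrite {1}Eb /base hp.
rewrite -Ebp; set D := \sum_(j <- w) _; set W := \sum_(j <- w) _.
rewrite (addnC (ldeg b)); have := digsumD_le p_gt1 (D + ldeg b) (ldeg (pend st)).
have := pend_bound st; lia.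
Qed.

End Critical.

(** * Weight filtration and grading of polynomials *)

Local Open Scope ring_scope.

Local Notation sub f z := (comp_mpoly [tuple f v | v < _] z).

Section Substitution.
Variable R : comNzRingType.

Lemma subX N N' (f : 'I_N -> {mpoly R[N']}) m :
  sub f 'X_[m] = \prod_(v < N) f v ^+ m v.
Proof. by rewrite comp_mpolyX; apply: eq_bigr => v _; rewrite tnth_mktuple. Qed.

Lemma subU N N' (f : 'I_N -> {mpoly R[N']}) v : sub f 'X_v = f v.
Proof. by rewrite comp_mpolyXU -tnth_nth tnth_mktuple. Qed.

Lemma sub_sum N N' (f : 'I_N -> {mpoly R[N']}) (I : Type) (r : seq I) (P : pred I)
    (a : I -> R) (g : I -> {mpoly R[N]}) :
  sub f (\sum_(i <- r | P i) a i *: g i) = \sum_(i <- r | P i) a i *: sub f (g i).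
Proof. by rewrite linear_sum; apply: eq_bigr => i _; rewrite linearZ. Qed.

Lemma subE N N' (f : 'I_N -> {mpoly R[N']}) z :
  sub f z = \sum_(m <- msupp z) z@_m *: sub f 'X_[m].
Proof.
by rewrite {1}(mpolyE z) sub_sum.
Qed.

Lemma eq_sub N N' (f g : 'I_N -> {mpoly R[N']}) z : f =1 g -> sub f z = sub g z.
Proof. by move=> E; congr comp_mpoly; apply: eq_mktuple. Qed.

Lemma sub_comp N N' N'' (f : 'I_N' -> {mpoly R[N'']}) (g : 'I_N -> {mpoly R[N']}) z :
  sub f (sub g z) = sub (fun v => sub f (g v)) z.
Proof.
rewrite (subE g) (subE _ z) linear_sum; apply: eq_bigr => m _.
rewrite linearZ /= !subX rmorph_prod; congr (_ *: _).
by apply: eq_bigr => v _; rewrite rmorphXn.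
Qed.

End Substitution.

Section Filtration.
Variable p : nat.
Hypothesis p_pr : prime p.
Let p_gt1 : (1 < p)%N := prime_gt1 p_pr.

Local Notation F := 'F_p.

Lemma pchar_mpolyFp N : p \in [pchar {mpoly F[N]}].
Proof.
rewrite inE p_pr /= -(rmorph_nat (@mpolyC N F)).
by have /andP[_ /eqP ->] := pchar_Fp p_pr; rewrite rmorph0.
Qed.

Lemma expFp (c : F) : c ^+ p = c.
Proof. by have := expf_card c; rewrite card_Fp. Qed.

Lemma mpoly_expD N (z z' : {mpoly F[N]}) : (z + z') ^+ p = z ^+ p + z' ^+ p.
Proof. by rewrite -!(pFrobenius_autE (pchar_mpolyFp N)) rmorphD. Qed.

Lemma mpoly_expB N (z z' : {mpoly F[N]}) : (z - z') ^+ p = z ^+ p - z' ^+ p.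
Proof. by rewrite -!(pFrobenius_autE (pchar_mpolyFp N)) rmorphB. Qed.

Lemma mpoly_exp_sum N (I : Type) (r : seq I) (P : pred I) (z : I -> {mpoly F[N]}) l :
  (\sum_(i <- r | P i) z i) ^+ (p ^ l) = \sum_(i <- r | P i) z i ^+ (p ^ l).
Proof.
elim: l => [|l IH]; first by rewrite expr1; apply: eq_bigr => i _; rewrite expr1.
rewrite expnSr exprM IH -(pFrobenius_autE (pchar_mpolyFp N)) rmorph_sum.
by apply: eq_bigr => i _; rewrite /= pFrobenius_autE -exprM.
Qed.

Lemma mpoly_expD_l N (z z' : {mpoly F[N]}) l :
  (z + z') ^+ (p ^ l) = z ^+ (p ^ l) + z' ^+ (p ^ l).
Proof. by elim: l => [|l IH]; rewrite ?expr1 // expnSr !exprM IH mpoly_expD. Qed.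

Lemma mpoly_expp N (z : {mpoly F[N]}) l :
  z ^+ (p ^ l) = \sum_(m <- msupp z) z@_m *: 'X_[m *+ (p ^ l)].
Proof.
rewrite {1}(mpolyE z) mpoly_exp_sum; apply: eq_bigr => m _.
rewrite exprZn mpolyXn; congr (_ *: _).
by elim: l => [|l IH]; rewrite ?expr1 // expnSr exprM IH expFp.
Qed.

Section Bound.
Variable N : nat.
Variable om : 'I_N -> nat.
Implicit Types (z : {mpoly F[N]}) (M r : nat).

Definition mwt (m : 'X_{1..N}) := (\sum_(v < N) om v * digsum p (m v))%N.
(** Membership in F_(M-r), with [r] moved to the left so that no truncated subtraction enters; for
    [r > M] it forces [z = 0]. *)
Definition bd M r z := forall m, m \in msupp z -> (mwt m + r <= M)%N.

Lemma mwtD_le m m' : (mwt (m + m')%MM <= mwt m + mwt m')%N.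
Proof.
rewrite /mwt -big_split; apply: leq_sum => v _.
by rewrite mnmDE /= -mulnDr leq_mul2l digsumD_le ?orbT.
Qed.

Lemma mwt_exp m l : mwt (m *+ (p ^ l))%MM = mwt m.
Proof.
by apply: eq_bigr => v _; rewrite mulmnE [(m v * _)%N]mulnC digsum_expM.
Qed.

Lemma bd0 M r : bd M r 0.
Proof. by move=> m; rewrite msupp0. Qed.

Lemma bdD M r z z' : bd M r z -> bd M r z' -> bd M r (z + z').
Proof.
move=> h h' m /msuppD_le; rewrite mem_cat => /orP[/h|/h'] //.
Qed.

Lemma bdN M r z : bd M r z -> bd M r (- z).
Proof. by move=> h m; rewrite (perm_mem (msuppN z)) => /h. Qed.

Lemma bdB M r z z' : bd M r z -> bd M r z' -> bd M r (z - z').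
Proof. by move=> h h'; apply: bdD => //; apply: bdN. Qed.

Lemma bdZ M r c z : bd M r z -> bd M r (c *: z).
Proof. by move=> h m /msuppZ_le /h. Qed.

Lemma bd_sum M r (I : eqType) (s : seq I) (P : pred I) (f : I -> {mpoly F[N]}) :
  (forall i, i \in s -> P i -> bd M r (f i)) -> bd M r (\sum_(i <- s | P i) f i).
Proof.
move=> h; rewrite big_seq_cond.
by elim/big_rec: _ => [|i z /andP[hi Pi] hz]; [exact: bd0 | apply: bdD => //; apply: h].
Qed.

Lemma bdM M r M' r' z z' : bd M r z -> bd M' r' z' -> bd (M + M') (r + r') (z * z').
Proof.
move=> h h' m /msuppM_le/allpairsP[[m1 m2] /= [/h h1 /h' h2 ->]].
have := mwtD_le m1 m2; lia.
Qed.

Lemma bd1 : bd 0 0 1.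
Proof.
move=> m; rewrite msupp1 inE => /eqP ->; rewrite /mwt big1 // => v _.
by rewrite mnm0E digsum0 muln0.
Qed.

Lemma bdX m M r : (mwt m + r <= M)%N -> bd M r 'X_[m].
Proof. by move=> h m'; rewrite msuppX inE => /eqP ->. Qed.

Lemma bd_expp M r z l : bd M r z -> bd M r (z ^+ (p ^ l)).
Proof.
move=> h; rewrite mpoly_expp; apply: bd_sum => m hm _; apply/bdZ/bdX.
by rewrite mwt_exp; apply: h.
Qed.

Lemma bd_le M r M' r' z : (M + r' <= M' + r)%N -> bd M r z -> bd M' r' z.
Proof. by move=> le h m /h; lia. Qed.

Definition cong M z z' := [/\ bd M 0 z, bd M 0 z' & bd M 1 (z - z')].

Lemma congM M M' z z' w w' : cong M z z' -> cong M' w w' -> cong (M + M') (z * w) (z' * w').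
Proof.
move=> [a b c] [a' b' c'].
have E : (z * w - z' * w') = (z - z') * w + z' * (w - w').
  by rewrite mulrBl mulrBr addrA subrK.
split; [exact: (bdM a a') | exact: (bdM b b') | rewrite E; apply: bdD].
  exact: (bdM c a').
exact: (bdM b c').
Qed.

Lemma cong1 : cong 0 1 1.
Proof. by split; rewrite ?subrr; [exact: bd1 | exact: bd1 | exact: bd0]. Qed.

Lemma cong_expp M z z' : cong M z z' -> cong M (z ^+ p) (z' ^+ p).
Proof.
have e M' r w : bd M' r w -> bd M' r (w ^+ p).
  by move=> hw; have := bd_expp (l := 1%N) hw; rewrite expn1.
by move=> [a b c]; split; [exact: e | exact: e | rewrite -mpoly_expB; exact: e].
Qed.

(** The power is a product of Frobenius powers along the digits of [e]. Since p-th powers do not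
    raise the weight, only the digit sum counts. *)
Lemma cong_exp M z z' e : cong M z z' -> cong (M * digsum p e) (z ^+ e) (z' ^+ e).
Proof.
have [m] := ubnP e; elim: m e z z' => // m IH e z z' hm h.
have small r : cong (M * r) (z ^+ r) (z' ^+ r).
  elim: r => [|r IHr]; first by rewrite muln0; exact: cong1.
  by rewrite !exprS mulnS; exact: congM.
have [->|e0] := posnP e; first by rewrite digsum0 muln0; exact: cong1.
have E (x : {mpoly F[N]}) : x ^+ e = (x ^+ p) ^+ (e %/ p) * x ^+ (e %% p).
  by rewrite {1}(divn_eq e p) exprD mulnC exprM.
rewrite digsum_rec // mulnDr addnC !E; apply: congM; last exact: small.
apply: IH; last exact: cong_expp.
exact: leq_trans (ltn_Pdiv p_gt1 e0) hm.
Qed.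

Lemma cong_prod (I : Type) (s : seq I) (Mi : I -> nat) (z z' : I -> {mpoly F[N]}) :
  (forall i, cong (Mi i) (z i) (z' i)) ->
  cong (\sum_(i <- s) Mi i) (\prod_(i <- s) z i) (\prod_(i <- s) z' i).
Proof.
move=> h; elim: s => [|i s IH]; first by rewrite !big_nil; exact: cong1.
by rewrite !big_cons; exact: congM.
Qed.

Variable dl : 'I_N -> nat.
Definition mdg (m : 'X_{1..N}) := (\sum_(v < N) m v * dl v)%N.
Definition homg t z := forall m, m \in msupp z -> mdg m = t.

Lemma homg0 t : homg t 0.
Proof. by move=> m; rewrite msupp0. Qed.

Lemma homgD t z z' : homg t z -> homg t z' -> homg t (z + z').
Proof. by move=> h h' m /msuppD_le; rewrite mem_cat => /orP[/h|/h']. Qed.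

Lemma homgN t z : homg t z -> homg t (- z).
Proof. by move=> h m; rewrite (perm_mem (msuppN z)) => /h. Qed.

Lemma homgB t z z' : homg t z -> homg t z' -> homg t (z - z').
Proof. by move=> h h'; apply: homgD => //; apply: homgN. Qed.

Lemma homgZ t c z : homg t z -> homg t (c *: z).
Proof. by move=> h m /msuppZ_le /h. Qed.

Lemma homg_sum t (I : eqType) (s : seq I) (P : pred I) (f : I -> {mpoly F[N]}) :
  (forall i, i \in s -> P i -> homg t (f i)) -> homg t (\sum_(i <- s | P i) f i).
Proof.
move=> h; rewrite big_seq_cond.
by elim/big_rec: _ => [|i z /andP[hi Pi] hz]; [exact: homg0 | apply: homgD => //; apply: h].
Qed.

Lemma homgM t t' z z' : homg t z -> homg t' z' -> homg (t + t') (z * z').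
Proof.
move=> h h' m /msuppM_le/allpairsP[[m1 m2] /= [/h <- /h' <- ->]].
by rewrite /mdg -big_split; apply: eq_bigr => v _; rewrite mnmDE mulnDl.
Qed.

Lemma homg1 : homg 0 1.
Proof. by move=> m; rewrite msupp1 inE => /eqP ->; apply: big1 => v _; rewrite mnm0E. Qed.

Lemma homgX m : homg (mdg m) 'X_[m].
Proof. by move=> m'; rewrite msuppX inE => /eqP ->. Qed.

Lemma homg_exp t z e : homg t z -> homg (e * t) (z ^+ e).
Proof.
move=> h; elim: e => [|e IH]; first exact: homg1.
by rewrite exprS mulSn; exact: homgM.
Qed.

Lemma homg_prod (I : Type) (s : seq I) (ti : I -> nat) (z : I -> {mpoly F[N]}) :
  (forall i, homg (ti i) (z i)) -> homg (\sum_(i <- s) ti i) (\prod_(i <- s) z i).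
Proof.
move=> h; elim: s => [|i s IH]; first by rewrite !big_nil; exact: homg1.
by rewrite !big_cons; exact: homgM.
Qed.

End Bound.

Section SubBound.
Variables (N N' : nat) (om : 'I_N -> nat) (om' : 'I_N' -> nat).
Variables (f f' : 'I_N -> {mpoly F[N']}).

Lemma cong_subX : (forall v, cong om' (om v) (f v) (f' v)) ->
  forall m, cong om' (mwt om m) (sub f 'X_[m]) (sub f' 'X_[m]).
Proof.
move=> h m; rewrite !subX /mwt.
apply: cong_prod => v; exact: cong_exp.
Qed.

Lemma bd_sub M r z : (forall v, bd om' (om v) 0 (f v)) -> bd om M r z -> bd om' M r (sub f z).
Proof.
move=> h hz; rewrite subE; apply: bd_sum => m hm _; apply: bdZ.
apply: bd_le (_ : (mwt om m + r <= M + 0)%N) _; first by rewrite addn0; apply: hz.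
rewrite subX /mwt.
have: cong om' (mwt om m) (\prod_(v < N) f v ^+ m v) (\prod_(v < N) f v ^+ m v).
  apply: cong_prod => v; apply: cong_exp; split=> //.
  by rewrite subrr; exact: bd0.
by case.
Qed.

Lemma homg_sub (dl : 'I_N -> nat) (dl' : 'I_N' -> nat) t z :
  (forall v, homg dl' (dl v) (f v)) -> homg dl t z -> homg dl' t (sub f z).
Proof.
move=> h hz; rewrite subE; apply: homg_sum => m hm _; apply: homgZ.
rewrite -(hz m hm) subX; apply: homg_prod => v; exact: homg_exp.
Qed.

End SubBound.
End Filtration.

(** * Faces of the cobar complex *)

(* Without this, unification tries to decide equality of polynomials by
   computing with their representations. *)
Local Opaque comp_mpoly GRing.exp expn.

Lemma addr_shuffle (V : zmodType) (x y z A B C D : V) :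
  x + y + D + z + (A + B + C) = x + (y + z + B) + (D + A + C).
Proof.
rewrite -!addrA; congr (_ + (_ + _)); rewrite addrCA; congr (_ + _).
by rewrite [RHS]addrCA; congr (_ + _); rewrite [RHS]addrCA.
Qed.


Section Faces.
Variables p n k : nat.
Hypothesis p_pr : prime p.
Hypothesis n_gt0 : (0 < n)%N.

Local Notation F := 'F_p.
Local Notation blk s b a := (blk p s n b a).

Lemma blk_ltn s b a : (b < s -> a < n -> b * n + a < s * n)%N.
Proof.
move=> bs an; apply: (@leq_trans (b.+1 * n)); last by rewrite leq_mul2r bs orbT.
by rewrite mulSn addnC ltn_add2r.
Qed.

Lemma blkE s b a (bs : (b < s)%N) (an : (a < n)%N) :
  blk s b a = 'X_(Ordinal (blk_ltn bs an)).
Proof. by rewrite /Defs.blk an (insubT (fun x => (x < s * n)%N) (blk_ltn bs an)). Qed.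

Lemma ord_div s (v : 'I_(s * n)) : (v %/ n < s)%N.
Proof. by rewrite ltn_divLR. Qed.

Lemma ord_mod s (v : 'I_(s * n)) : (v %% n < n)%N.
Proof. exact: ltn_pmod. Qed.

Lemma blk_ord s (v : 'I_(s * n)) : blk s (v %/ n) (v %% n) = 'X_v.
Proof.
rewrite (blkE (ord_div v) (ord_mod v)); congr 'X_ _.
by apply: val_inj; rewrite /= -divn_eq.
Qed.

Lemma sub_blk N s (G : nat -> nat -> {mpoly F[N]}) b a : (b < s)%N -> (a < n)%N ->
  sub (fun v : 'I_(s * n) => G (v %/ n)%N (v %% n)%N) (blk s b a) = G b a.
Proof.
move=> bs an; rewrite (blkE bs an) subU /= divnMDl // divn_small // addn0.
by rewrite modnMDl modn_small.
Qed.

Section Coproduct.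
Variables (N : nat).
Implicit Types x y z : nat -> {mpoly F[N]}.

(** Arbitrary families stand in for the two tensor factors of the coproduct, so that faces and their
    composites are instances of one expression. *)
Definition cop_val x y a :=
  x a + y a + \sum_(k <= r < a.+1) x (r - k)%N * y (a - r)%N ^+ (p ^ r).

Lemma sub_copT (H : nat -> nat -> {mpoly F[N]}) a : (a < n)%N ->
  sub (fun v : 'I_(2 * n) => H (v %/ n)%N (v %% n)%N) (copT p n k a) =
  cop_val (H 0%N) (H 1%N) a.
Proof.
move=> an; rewrite /copT !rmorphD /= !(@sub_blk _ 2 H) // rmorph_sum; congr (_ + _).
apply: eq_big_nat => r /andP[kr ra]; rewrite rmorphM rmorphXn /= !(@sub_blk _ 2 H) //; lia.
Qed.

(** The p-power map is additive in characteristic [p], so the outer power distributes over the inner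
    coproduct; what remains is a reindexing of the triple products. *)
Lemma cop_val_coassoc x y z a :
  cop_val (cop_val x y) z a = cop_val x (cop_val y z) a.
Proof.
have E1 : \sum_(k <= r < a.+1) (x (r - k)%N + y (r - k)%N +
      \sum_(k <= q < (r - k).+1) x (q - k)%N * y (r - k - q)%N ^+ (p ^ q)) *
      z (a - r)%N ^+ (p ^ r) =
    \sum_(k <= r < a.+1) x (r - k)%N * z (a - r)%N ^+ (p ^ r) +
    \sum_(k <= r < a.+1) y (r - k)%N * z (a - r)%N ^+ (p ^ r) +
    \sum_(k <= r < a.+1) \sum_(k <= q < (r - k).+1)
      x (q - k)%N * y (r - k - q)%N ^+ (p ^ q) * z (a - r)%N ^+ (p ^ r).
  transitivity (\sum_(k <= r < a.+1) (x (r - k)%N * z (a - r)%N ^+ (p ^ r) +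
      y (r - k)%N * z (a - r)%N ^+ (p ^ r) + \sum_(k <= q < (r - k).+1)
      x (q - k)%N * y (r - k - q)%N ^+ (p ^ q) * z (a - r)%N ^+ (p ^ r))).
    by apply: eq_bigr => r _; rewrite mulrDl mulrDl mulr_suml.
  by rewrite big_split big_split.
have E2 : \sum_(k <= r < a.+1) x (r - k)%N * (y (a - r)%N + z (a - r)%N +
      \sum_(k <= q < (a - r).+1) y (q - k)%N * z (a - r - q)%N ^+ (p ^ q)) ^+ (p ^ r) =
    \sum_(k <= r < a.+1) x (r - k)%N * y (a - r)%N ^+ (p ^ r) +
    \sum_(k <= r < a.+1) x (r - k)%N * z (a - r)%N ^+ (p ^ r) +
    \sum_(k <= r < a.+1) \sum_(k <= q < (a - r).+1)
      x (r - k)%N * (y (q - k)%N ^+ (p ^ r) * z (a - r - q)%N ^+ (p ^ (q + r))).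
  transitivity (\sum_(k <= r < a.+1) (x (r - k)%N * y (a - r)%N ^+ (p ^ r) +
      x (r - k)%N * z (a - r)%N ^+ (p ^ r) + \sum_(k <= q < (a - r).+1)
      x (r - k)%N * (y (q - k)%N ^+ (p ^ r) * z (a - r - q)%N ^+ (p ^ (q + r))))).
    apply: eq_bigr => r _.
    rewrite mpoly_expD_l // mpoly_expD_l // mpoly_exp_sum // mulrDr mulrDr mulr_sumr.
    by congr (_ + _); apply: eq_bigr => q _; rewrite exprMn -exprM expnD.
  by rewrite big_split big_split.
(* The pairs with [q + k <= r] are summed in the other order, and [r] is shifted by [q]. *)
have E3 : \sum_(k <= r < a.+1) \sum_(k <= q < (r - k).+1)
      x (q - k)%N * y (r - k - q)%N ^+ (p ^ q) * z (a - r)%N ^+ (p ^ r) =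
    \sum_(k <= r < a.+1) \sum_(k <= q < (a - r).+1)
      x (r - k)%N * (y (q - k)%N ^+ (p ^ r) * z (a - r - q)%N ^+ (p ^ (q + r))).
  pose g q r := x (q - k)%N * y (r - k - q)%N ^+ (p ^ q) * z (a - r)%N ^+ (p ^ r).
  transitivity (\sum_(k <= r < a.+1) \sum_(k <= q < a.+1 | (q + k <= r)%N) g q r).
    rewrite big_nat [RHS]big_nat; apply: eq_bigr => r /andP[kr ra].
    rewrite (big_nat_widen _ _ a.+1); last by lia.
    by apply: congr_big => // q; rewrite /= ?andbT; lia.
  rewrite (exchange_big_dep_nat xpredT) //=.
  rewrite big_nat [RHS]big_nat; apply: eq_bigr => q /andP[kq qa].
  transitivity (\sum_(k + q <= r < a.+1) g q r).
    rewrite (big_nat_widenl (k + q) k) ?leq_addr //; apply: eq_bigl => r.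
    by rewrite addnC.
  rewrite big_addn; have -> : (a.+1 - q = (a - q).+1)%N by lia.
  apply: eq_big_nat => r /andP[kr ra]; rewrite /g.
  have -> : (r + q - k - q = r - k)%N by lia.
  have -> : (a - (r + q) = a - q - r)%N by lia.
  by rewrite mulrA.
rewrite E3 in E1.
pose A := \sum_(k <= r < a.+1) x (r - k)%N * z (a - r)%N ^+ (p ^ r).
pose B := \sum_(k <= r < a.+1) y (r - k)%N * z (a - r)%N ^+ (p ^ r).
pose D := \sum_(k <= r < a.+1) x (r - k)%N * y (a - r)%N ^+ (p ^ r).
pose C := \sum_(k <= r < a.+1) \sum_(k <= q < (a - r).+1)
      x (r - k)%N * (y (q - k)%N ^+ (p ^ r) * z (a - r - q)%N ^+ (p ^ (q + r))).
have L : cop_val (cop_val x y) z a = x a + y a + D + z a + (A + B + C).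
  exact: congr1 E1.
have L' : cop_val x (cop_val y z) a = x a + (y a + z a + B) + (D + A + C).
  exact: congr1 E2.
rewrite L L'; exact: addr_shuffle.
Qed.
End Coproduct.


Local Notation cop := (copT p n k).
Local Notation place s c q := (place p s n c q).
Local Notation face s i z := (face p n cop s i z).

Definition fval s i b a : {mpoly F[s.+1 * n]} :=
  if (b.+1 < i)%N then blk s.+1 b a
  else if b.+1 == i then place s.+1 b (cop a) else blk s.+1 b.+1 a.

Lemma faceE s i z : face s i z = sub (fun v : 'I_(s * n) => fval s i (v %/ n)%N (v %% n)%N) z.
Proof. by []. Qed.

Lemma face_blk s i b a : (b < s)%N -> (a < n)%N -> face s i (blk s b a) = fval s i b a.
Proof. by move=> bs an; rewrite faceE sub_blk. Qed.

Lemma place_cop s b a : (a < n)%N ->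
  place s b (cop a) = cop_val (fun a => blk s b a) (fun a => blk s b.+1 a) a.
Proof.
move=> an.
have := @sub_copT (s * n) (fun i a => blk s (b + i) a) a an.
rewrite /= addn0 addn1.
exact.
Qed.

Lemma eq_cop_val N (x x' y y' : nat -> {mpoly F[N]}) a :
  (forall c, (c <= a)%N -> x c = x' c) -> (forall c, (c <= a)%N -> y c = y' c) ->
  cop_val x y a = cop_val x' y' a.
Proof.
move=> Ex Ey.
have E : \sum_(k <= r < a.+1) x (r - k)%N * y (a - r)%N ^+ (p ^ r) =
         \sum_(k <= r < a.+1) x' (r - k)%N * y' (a - r)%N ^+ (p ^ r).
  apply: eq_big_nat => r /andP[kr ra].
  by rewrite (Ex (r - k)%N ltac:(lia)) (Ey (a - r)%N ltac:(lia)).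
exact (f_equal2 +%R (f_equal2 +%R (Ex a (leqnn a)) (Ey a (leqnn a))) E).
Qed.

Lemma face_place s i b a : (b.+1 < s)%N -> (a < n)%N ->
  face s i (place s b (cop a)) = cop_val (fval s i b) (fval s i b.+1) a.
Proof.
move=> bs an; 
have := @sub_copT (s.+1 * n) (fun j a => fval s i (b + j) a) a an.
rewrite /= addn0 addn1 => <-.
rewrite {1}/Defs.place faceE sub_comp.
apply: eq_sub => v /=; rewrite sub_blk ?ord_mod //.
by have := ord_div v; lia.
Qed.

Lemma fval_lt s i b a : (b.+1 < i)%N -> fval s i b a = blk s.+1 b a.
Proof. by rewrite /fval => ->. Qed.

Lemma fval_gt s i b a : (i < b.+1)%N -> fval s i b a = blk s.+1 b.+1 a.
Proof. by rewrite /fval => h; rewrite ltnNge (ltnW h) /= (gtn_eqF h). Qed.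

Lemma fval_eq s b a : (a < n)%N -> fval s b.+1 b a =
  cop_val (fun a => blk s.+1 b a) (fun a => blk s.+1 b.+1 a) a.
Proof. by move=> an; rewrite /fval ltnn eqxx place_cop. Qed.

Lemma face_cop s i b a : (b.+1 < s)%N -> (a < n)%N ->
  face s i (cop_val (fun a => blk s b a) (fun a => blk s b.+1 a) a) =
  cop_val (fval s i b) (fval s i b.+1) a.
Proof. by move=> bs an; rewrite -place_cop // face_place. Qed.

(** Checked on variables by comparing their block with [i] and [j]. Coassociativity is needed only
    when both faces hit the same block, that is [i = j = b.+1]. *)
Lemma face_face s i j z : (i <= j)%N -> face s.+1 j.+1 (face s i z) = face s.+1 i (face s j z).
Proof.
move=> ij.
rewrite !faceE !sub_comp; apply: eq_sub => v.
have bs := ord_div v; have an := ord_mod v.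
move: (v %/ n)%N (v %% n)%N bs an => b a bs an {v}; rewrite -!faceE /=.
have bs1 : (b < s.+1)%N by apply: ltnW.
have bs2 : (b.+1 < s.+1)%N by [].
have [h|h|h] := ltngtP b.+1 i.
- have h' : (b.+1 < j)%N by apply: leq_trans ij.
  rewrite (fval_lt _ _ h) (fval_lt _ _ h') (face_blk _ bs1 an) (face_blk _ bs1 an).
  by rewrite (fval_lt _ _ h) (fval_lt _ _ (ltnW h' : (b.+1 < j.+1)%N)).
- rewrite (fval_gt _ _ h) (face_blk _ bs2 an).
  have [h'|h'|h'] := ltngtP b.+1 j.
  + rewrite (fval_lt _ _ h') (face_blk _ bs1 an) (fval_gt _ _ h) fval_lt; last by [].
    by [].
  + rewrite (fval_gt _ _ h') (face_blk _ bs2 an) fval_gt; last by [].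
    by rewrite fval_gt; last exact: ltnW.
  rewrite -h' fval_eq; last by [].
  rewrite fval_eq; last by [].
  rewrite face_cop; [|by []..].
  apply: eq_cop_val => c _; rewrite fval_gt; [by []|lia|by []|lia].
rewrite -h (fval_eq s b an) (face_cop _ bs2 an).
have [h'|h'|h'] := ltngtP b.+1 j.
- rewrite (fval_lt _ _ h') (face_blk _ bs1 an) (fval_eq _ b an).
  apply: eq_cop_val => c _; rewrite fval_lt; [by []|lia|by []|lia].
- by move: h'; rewrite -h in ij; rewrite ltnNge ij.
rewrite -h' (fval_eq s b an) (face_cop _ bs2 an).
have L c : (c <= a)%N -> fval s.+1 b.+2 b.+1 c =
    cop_val (fun a => blk s.+2 b.+1 a) (fun a => blk s.+2 b.+2 a) c.
  by move=> ca; rewrite fval_eq; last exact: leq_ltn_trans an.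
have L' c : (c <= a)%N -> fval s.+1 b.+1 b c =
    cop_val (fun a => blk s.+2 b a) (fun a => blk s.+2 b.+1 a) c.
  by move=> ca; rewrite fval_eq; last exact: leq_ltn_trans an.
rewrite (@eq_cop_val _ _ (fun a => blk s.+2 b a) _ _ a _ L); last first.
  by move=> c _; apply: fval_lt; apply: leqnn.
rewrite -cop_val_coassoc; apply/esym; apply: eq_cop_val; first exact: L'.
by move=> c _; apply: fval_gt; apply: leqnn.
Qed.

(** The terms with [i < j], after lowering [j] by one, are the terms with [j <= i] under the
    hypothesis on [A], with opposite sign. *)
Lemma alternating_double_sum (V : lmodType F) N (A : nat -> nat -> V) :
  (forall i j, (i <= j)%N -> A j.+1 i = A i j) ->
  \sum_(j < N.+1) (-1) ^+ j *: (\sum_(i < N) (-1) ^+ i *: A j i) = 0.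
Proof.
move=> hA; pose T i j := ((-1) ^+ j * (-1) ^+ i : F) *: A j i.
transitivity (\sum_(j < N.+1) (\sum_(i < N | (i < j)%N) T i j +
                               \sum_(i < N | (j <= i)%N) T i j)).
  apply: eq_bigr => j _; rewrite scaler_sumr (bigID (fun i : 'I_N => (i < j)%N)) /=.
  congr (_ + _).
    by apply: eq_bigr => i _; rewrite scalerA.
  by apply: eq_big => i; rewrite -?leqNgt // scalerA.
rewrite big_split /= big_ord_recl [X in X + _ + _]big1 ?add0r => [|i]; last by rewrite ltn0.
rewrite [X in _ + X]big_ord_recr [X in _ + (_ + X)]big1 => [|i]; last first.
  by rewrite /= leqNgt ltn_ord.
rewrite addr0 [X in _ + X](exchange_big_dep xpredT) //= -big_split big1 // => j _.
apply/eqP; rewrite addr_eq0 -sumrN; apply/eqP.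
apply: eq_big => [i|i /= ij]; first by rewrite /bump /= add1n ltnS.
rewrite /T /bump /= add1n hA; last by move: ij; rewrite /bump /= add1n ltnS.
by rewrite exprS mulN1r mulNr scaleNr mulrC.
Qed.

Local Notation d s z := (dcob p n cop s z).

Lemma dcobD s z z' : d s (z + z') = d s z + d s z'.
Proof.
rewrite /dcob -big_split; apply: eq_bigr => i _.
by rewrite /= -scalerDr /Defs.face raddfD.
Qed.

Lemma dcobZ s c z : d s (c *: z) = c *: d s z.
Proof.
rewrite /dcob scaler_sumr; apply: eq_bigr => i _.
by rewrite !scalerA [c * _]mulrC -scalerA /Defs.face linearZ.
Qed.

Lemma dcobN s z : d s (- z) = - d s z.
Proof. by rewrite -scaleN1r dcobZ scaleN1r. Qed.

Lemma dcobB s z z' : d s (z - z') = d s z - d s z'.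
Proof. by rewrite dcobD dcobN. Qed.

Lemma dcob0 s : d s 0 = 0.
Proof. by rewrite -(scale0r 0) dcobZ scale0r. Qed.

Lemma dcob_dcob s z : d s.+1 (d s z) = 0.
Proof.
rewrite -[RHS](@alternating_double_sum _ s.+2 (fun j i => face s.+1 j (face s i z)));
  last by move=> i j; exact: face_face.
apply: eq_bigr => j _; congr (_ *: _).
rewrite /dcob /Defs.face linear_sum; apply: eq_bigr => i _.
by rewrite linearZ.
Qed.

End Faces.

(** * The differential, its leading part and normalization *)

Section Preservation.
Variables p n k : nat.
Hypothesis p_pr : prime p.
Hypothesis n_gt0 : (0 < n)%N.
Hypothesis k_gt0 : (0 < k)%N.

Let p_gt1 : (1 < p)%N := prime_gt1 p_pr.

Local Notation F := 'F_p.
Local Notation blk s b a := (blk p s n b a).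
Local Notation cop := (copT p n k).
Local Notation face s i z := (face p n cop s i z).
Local Notation d s z := (dcob p n cop s z).
Local Notation fvl := (fval p n k).
Local Notation cpv := (cop_val k).

Definition om s (v : 'I_(s * n)) := (2 * (k + v %% n) - 1)%N.
Definition dl s (v : 'I_(s * n)) := (2 * (p ^ (k + v %% n) - 1))%N.

Lemma bd_blk s b a : (b < s)%N -> (a < n)%N ->
  bd (@om s) (2 * (k + a) - 1) 0 (blk s b a).
Proof.
move=> bs an; rewrite (blkE p bs an); apply: bdX; rewrite addn0 /mwt.
set o := Ordinal _; rewrite (bigD1 o) //= big1 => [|v vo].
  rewrite mnm1E eqxx addn0 /om /= modnMDl modn_small //.
  by rewrite digsum_small // muln1.
by rewrite mnm1E eq_sym (negbTE vo) digsum0 muln0.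
Qed.

Lemma homg_blk s b a : (b < s)%N -> (a < n)%N ->
  homg (@dl s) (2 * (p ^ (k + a) - 1)) (blk s b a).
Proof.
move=> bs an; rewrite (blkE p bs an); set o := Ordinal _.
suff -> : (2 * (p ^ (k + a) - 1) = mdg (@dl s) U_(o))%N by exact: homgX.
rewrite /mdg (bigD1 o) //= big1 => [|v vo].
  by rewrite mnm1E eqxx addn0 /dl /= modnMDl modn_small // mul1n.
by rewrite mnm1E eq_sym (negbTE vo).
Qed.

(** The weights [2r - 1] and [2(k + a - r) - 1] add up to one less than [2(k + a) - 1], and the
    power [p ^ r] is free of weight. Hence generators become primitive in the associated graded
    algebra. *)
Lemma bd_cop s b a : (b.+1 < s)%N -> (a < n)%N ->
  bd (@om s) (2 * (k + a) - 1) 1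
    (\sum_(k <= r < a.+1) blk s b (r - k) * blk s b.+1 (a - r) ^+ (p ^ r)).
Proof.
move=> bs an; apply: bd_sum => r; rewrite mem_index_iota => /andP[kr ra] _.
have h1 : bd (@om s) (2 * (k + (r - k)) - 1) 0 (blk s b (r - k)).
  by apply: bd_blk; [exact: ltnW | lia].
have h2 : bd (@om s) (2 * (k + (a - r)) - 1) 0 (blk s b.+1 (a - r)).
  by apply: bd_blk => //; lia.
by apply: bd_le (bdM p_pr h1 (bd_expp p_pr (l := r) h2)); lia.
Qed.

Lemma homg_cop s b a : (b.+1 < s)%N -> (a < n)%N ->
  homg (@dl s) (2 * (p ^ (k + a) - 1)) (cpv (fun a => blk s b a) (fun a => blk s b.+1 a) a).
Proof.
move=> bs an; rewrite /cop_val; apply: homgD; first apply: homgD.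
- by apply: homg_blk => //; exact: ltnW.
- exact: homg_blk.
apply: homg_sum => r; rewrite mem_index_iota => /andP[kr ra] _.
have h1 : homg (@dl s) (2 * (p ^ (k + (r - k)) - 1)) (blk s b (r - k)).
  by apply: homg_blk; [exact: ltnW | lia].
have h2 : homg (@dl s) (2 * (p ^ (k + (a - r)) - 1)) (blk s b.+1 (a - r)).
  by apply: homg_blk => //; lia.
have E : (2 * (p ^ (k + a) - 1) =
   2 * (p ^ (k + (r - k)) - 1) + p ^ r * (2 * (p ^ (k + (a - r)) - 1)))%N.
  have -> : (k + (r - k) = r)%N by lia.
  have -> : (p ^ (k + a) = p ^ r * p ^ (k + (a - r)))%N.
    by rewrite -expnD; congr expn; lia.
  have : (0 < p ^ r)%N by rewrite expn_gt0 ltnW.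
  have : (0 < p ^ (k + (a - r)))%N by rewrite expn_gt0 ltnW.
  by move: (p ^ r)%N (p ^ _)%N => x y; nia.
by rewrite E; apply: homgM => //; apply: homg_exp.
Qed.

(* Leading part of [fval]: the generators are primitive in the associated graded. *)
Definition pval s i b a : {mpoly F[s.+1 * n]} :=
  if (b.+1 < i)%N then blk s.+1 b a
  else if b.+1 == i then blk s.+1 b a + blk s.+1 b.+1 a else blk s.+1 b.+1 a.

Definition pface s i (z : {mpoly F[s * n]}) : {mpoly F[s.+1 * n]} :=
  sub (fun v : 'I_(s * n) => pval s i (v %/ n) (v %% n)) z.

Definition pd s (z : {mpoly F[s * n]}) : {mpoly F[s.+1 * n]} :=
  \sum_(i < s.+2) (-1) ^+ i *: pface i z.

Lemma cong_fval s i (v : 'I_(s * n)) :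
  cong (@om s.+1) (om v) (fvl s i (v %/ n) (v %% n)) (pval s i (v %/ n) (v %% n)).
Proof.
have bs := ord_div n_gt0 v; have an := ord_mod n_gt0 v.
rewrite /om; move: (v %/ n)%N (v %% n)%N bs an => b a bs an {v}.
have r z : bd (@om s.+1) (2 * (k + a) - 1) 0 z -> cong (@om s.+1) (2 * (k + a) - 1) z z.
  by move=> h; split=> //; rewrite subrr; exact: bd0.
have h1 : bd (@om s.+1) (2 * (k + a) - 1) 0 (blk s.+1 b a).
  by apply: bd_blk => //; exact: ltnW.
have h2 : bd (@om s.+1) (2 * (k + a) - 1) 0 (blk s.+1 b.+1 a) by exact: bd_blk.
rewrite /fval /pval; case: ifP => _; first exact: r.
case: ifP => _; last exact: r.
have h3 := bd_cop (bs : (b.+1 < s.+1)%N) an.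
have h12 := bdD h1 h2.
rewrite place_cop // /cop_val; split=> //.
  by apply: bdD => //; apply: bd_le h3; lia.
by rewrite addrC addKr.
Qed.

Lemma bd_face s i M r z : bd (@om s) M r z -> bd (@om s.+1) M r (face s i z).
Proof.
move=> h; rewrite faceE; apply: bd_sub h => // v.
by have [] := cong_fval i v.
Qed.

Lemma bd_dcob s M r z : bd (@om s) M r z -> bd (@om s.+1) M r (d s z).
Proof.
by move=> h; rewrite /dcob; apply: bd_sum => i _ _; apply: bdZ; exact: bd_face.
Qed.

Lemma homg_dcob s t z : homg (@dl s) t z -> homg (@dl s.+1) t (d s z).
Proof.
move=> h; rewrite /dcob; apply: homg_sum => i _ _; apply: homgZ.
rewrite faceE; apply: homg_sub h => v.
have bs := ord_div n_gt0 v; have an := ord_mod n_gt0 v.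
rewrite -[dl v]/(2 * (p ^ (k + v %% n) - 1))%N; move: (v %/ n)%N (v %% n)%N bs an => b a bs an {v}.
rewrite /fval; case: ifP => _; first by apply: homg_blk => //; exact: ltnW.
case: ifP => _; last exact: homg_blk.
by rewrite place_cop //; exact: homg_cop.
Qed.

Lemma bd_dcob_pd s M z : bd (@om s) M 0 z -> bd (@om s.+1) M 1 (d s z - pd z).
Proof.
move=> h; rewrite /dcob /pd -sumrB; apply: bd_sum => i _ _; rewrite -scalerBr; apply: bdZ.
rewrite faceE /pface (subE _ z) [X in _ - X]subE -sumrB; apply: bd_sum => m hm _.
rewrite -scalerBr; apply: bdZ.
have [_ _ hc] := cong_subX p_pr (cong_fval i) m.
by apply: bd_le hc; have := h m hm; lia.
Qed.

Lemma mcoeff_dcob s M z m : bd (@om s) M 0 z -> (M <= mwt p (@om s.+1) m)%N ->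
  (d s z)@_m = (pd z)@_m.
Proof.
move=> h hm; apply/eqP; rewrite -subr_eq0 -mcoeffB mcoeff_eq0; apply/negP.
by move=> /(bd_dcob_pd h); lia.
Qed.

(** * Normalized cochains *)

Section Normal.
Implicit Types s b : nat.

(** Keeps exactly the monomials that violate normalization at [b], which turns normalization into a
    statement about substitutions. *)
Definition kill s b (z : {mpoly F[s * n]}) : {mpoly F[s * n]} :=
  sub (fun v : 'I_(s * n) => if (v %/ n)%N == b then 0 else blk s (v %/ n) (v %% n)) z.

Lemma sub_eq0 s N (f : 'I_(s * n) -> {mpoly F[N]}) b z : (b < s)%N -> normalized p s n z ->
  (forall v : 'I_(s * n), (v %/ n)%N == b -> f v = 0) -> sub f z = 0.
Proof.
move=> bs hz hf; rewrite subE big_seq big1 // => m hm.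
have [v /andP[vb mv]] := hz m hm b bs.
rewrite subX (bigD1 v) //= hf // expr0n eqn0Ngt mv /=.
by rewrite mul0r scaler0.
Qed.

Lemma mcoeff_kill s b z (m : 'X_{1..s * n}) :
  (forall v : 'I_(s * n), (v %/ n)%N == b -> m v = 0%N) -> (kill b z)@_m = z@_m.
Proof.
move=> hm; rewrite /kill subE [in RHS](mpolyE z) !raddf_sum /=.
apply: eq_bigr => m' _; rewrite !mcoeffZ; congr (_ * _); rewrite subX.
have [/forallP h|] := boolP [forall v : 'I_(s * n), ((v %/ n)%N == b) ==> (m' v == 0%N)].
  have -> : \prod_(v < s * n) (if (v %/ n)%N == b then 0 else blk s (v %/ n) (v %% n)) ^+ m' v
       = 'X_[m'].
    rewrite [RHS]mpolyXE_id; apply: eq_bigr => v _; have := h v.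
    case: ifP => [_ /= /eqP -> |_ _]; first by rewrite !expr0.
    by rewrite blk_ord.
  by [].
rewrite negb_forall => /existsP[v]; rewrite negb_imply => /andP[vb mv].
rewrite (bigD1 v) //= vb expr0n (negbTE mv) /= mul0r mcoeff0.
rewrite mcoeffX; case: eqP => // E; move: mv.
by rewrite E hm.
Qed.

Lemma kill_blk s b c a : (c < s)%N -> (a < n)%N ->
  kill b (blk s c a) = if c == b then 0 else blk s c a.
Proof.
move=> cs an; rewrite /kill.
by rewrite (sub_blk n_gt0 (fun c a => if c == b then 0 else blk s c a)).
Qed.

Lemma kill_cop s b c a : (c.+1 < s)%N -> (a < n)%N ->
  kill b (cpv (fun a => blk s c a) (fun a => blk s c.+1 a) a) =
  cpv (fun a => if c == b then 0 else blk s c a)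
          (fun a => if c.+1 == b then 0 else blk s c.+1 a) a.
Proof.
move=> cs an; rewrite /cop_val /kill rmorphD rmorphD rmorph_sum /=.
rewrite -!/(kill b _) !kill_blk //; last exact: ltnW.
congr (_ + _); apply: eq_big_nat => r /andP[kr ra].
rewrite rmorphM rmorphXn /= -!/(kill b _) !kill_blk //; try lia.
Qed.

Lemma cop_val0l N (y : nat -> {mpoly F[N]}) a : cpv (fun=> 0) y a = y a.
Proof.
by rewrite /cop_val add0r big1 ?addr0 // => r _; rewrite mul0r.
Qed.

Lemma cop_val0r N (x : nat -> {mpoly F[N]}) a : cpv x (fun=> 0) a = x a.
Proof.
rewrite /cop_val addr0 big1 ?addr0 // => r _.
by rewrite expr0n eqn0Ngt expn_gt0 (ltnW p_gt1) /= mulr0.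
Qed.

Definition ins s b c a := blk s.+1 (if (c < b)%N then c else c.+1) a.

Lemma kill_fval_id s i b c a : (c < s)%N -> (a < n)%N -> i = b \/ i = b.+1 ->
  kill b (fvl s i c a) = ins s b c a.
Proof.
move=> cs an hi; have [h|h|h] := ltngtP c.+1 i.
- rewrite fval_lt // kill_blk //; last exact: ltnW.
  rewrite ifF; last by case: hi => ?; lia.
  by rewrite /ins ifT //; case: hi => ?; lia.
- rewrite fval_gt // kill_blk // /ins.
  by rewrite ifF ?ifF //; case: hi => ?; lia.
rewrite -h fval_eq // kill_cop // /ins.
case: hi => hi.
  have -> : (c == b) = false by lia.
  have -> : (c.+1 == b) = true by lia.
  have -> : (c < b)%N = true by lia.
  exact: cop_val0r.
have -> : (c == b) = true by lia.
have -> : (c.+1 == b) = false by lia.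
have -> : (c < b)%N = false by lia.
exact: cop_val0l.
Qed.

Lemma kill_face s i b z : kill b (face s i z) =
  sub (fun v : 'I_(s * n) => kill b (fvl s i (v %/ n) (v %% n))) z.
Proof. by rewrite faceE /kill sub_comp. Qed.

Lemma kill_face_eq0 s i b z : normalized p s n z -> (b < s.+1)%N -> (i < s.+2)%N ->
  i != b -> i != b.+1 -> kill b (face s i z) = 0.
Proof.
move=> hz bs is1 ib ib1; rewrite kill_face.
have [lt|ge] := ltnP i b.
  apply: (@sub_eq0 _ _ _ b.-1) hz _ => [|v /eqP ->]; first by lia.
  have an := ord_mod n_gt0 v.
  rewrite fval_gt; last by lia.
  by rewrite kill_blk ?ifT //; lia.
apply: (@sub_eq0 _ _ _ b) hz _ => [|v /eqP ->]; first by lia.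
have an := ord_mod n_gt0 v.
rewrite fval_lt; last by lia.
by rewrite kill_blk ?ifT //; lia.
Qed.

Lemma kill_dcob s b z :
  kill b (d s z) = \sum_(i < s.+2) (-1) ^+ i *: kill b (face s i z).
Proof.
by rewrite /dcob /kill linear_sum; apply: eq_bigr => i _; rewrite linearZ.
Qed.

(** Once block [b] is killed, faces [b] and [b.+1] agree by counitality and cancel in the
    alternating sum; every other face sends a whole block of [z], nonconstant in each monomial, into
    the killed one. *)
Lemma normalized_dcob s z : normalized p s n z -> normalized p s.+1 n (d s z).
Proof.
move=> hz m hm b bs; apply/existsP; apply: contraTT hm.
rewrite negb_exists => /forallP h.
have hb (v : 'I_(s.+1 * n)) : (v %/ n)%N == b -> m v = 0%N.
  by move=> vb; have := h v; rewrite vb /= -eqn0Ngt => /eqP.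
rewrite -mcoeff_eq0 -(mcoeff_kill _ hb) kill_dcob.
have b1 : (b < s.+2)%N by lia.
have b2 : (b.+1 < s.+2)%N by lia.
have I i : i = b \/ i = b.+1 -> kill b (face s i z) =
    sub (fun v : 'I_(s * n) => ins s b (v %/ n) (v %% n)) z.
  move=> hi; rewrite kill_face; apply: eq_sub => v.
  by apply: kill_fval_id hi; [exact: ord_div | exact: ord_mod].
pose K i := kill b (face s i z).
rewrite -[\sum_(i < s.+2) _]/(\sum_(i < s.+2) (-1) ^+ i *: K i).
have KJ : K b = K b.+1 by exact: etrans (I b (or_introl erefl)) (esym (I b.+1 (or_intror erefl))).
have K0 i : (i < s.+2)%N -> i != b -> i != b.+1 -> K i = 0.
  exact: kill_face_eq0 hz bs.
clearbody K; clear I.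
rewrite (bigD1 (Ordinal b1)) //= (bigD1 (Ordinal b2)) /=; last first.
  by rewrite -val_eqE /=; lia.
rewrite big1 => [|i /andP[i1 i2]]; last by rewrite K0 ?scaler0.
by rewrite KJ addr0 -scalerDl exprS mulN1r subrr scale0r mcoeff0.
Qed.

End Normal.
End Preservation.

(** * Coefficients of the primitive faces *)

Section Coefficients.
Variables p n k : nat.
Hypothesis p_pr : prime p.
Hypothesis n_gt0 : (0 < n)%N.

Let p_gt1 : (1 < p)%N := prime_gt1 p_pr.

Local Notation F := 'F_p.
Local Notation blk s b a := (blk p s n b a).

Definition at_ s (m : 'X_{1..s * n}) c a := nth 0%N m (c * n + a).

Lemma at_ord s (m : 'X_{1..s * n}) (v : 'I_(s * n)) : at_ m (v %/ n) (v %% n) = m v.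
Proof. by rewrite /at_ -divn_eq (mnm_nth 0%N). Qed.

Definition idx s c a (cs : (c < s)%N) (an : (a < n)%N) : 'I_(s * n) := Ordinal (blk_ltn cs an).

Lemma idx_div s c a (cs : (c < s)%N) (an : (a < n)%N) : (idx cs an %/ n)%N = c.
Proof. by rewrite /= divnMDl // divn_small // addn0. Qed.

Lemma idx_mod s c a (cs : (c < s)%N) (an : (a < n)%N) : (idx cs an %% n)%N = a.
Proof. by rewrite /= modnMDl modn_small. Qed.

Lemma idx_eq s (v w : 'I_(s * n)) : (v == w) = ((v %/ n == w %/ n) && (v %% n == w %% n))%N.
Proof.
apply/eqP/andP => [->//|[/eqP E1 /eqP E2]].
by apply: val_inj; rewrite /= (divn_eq v n) (divn_eq w n) E1 E2.
Qed.

Section Merge.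
Variables (s b : nat).
Hypothesis bs : (b < s)%N.

Definition mg (m : 'X_{1..s.+1 * n}) : 'X_{1..s * n} :=
  [multinom (if v %/ n < b then at_ m (v %/ n) (v %% n)
             else if v %/ n == b then at_ m b (v %% n) + at_ m b.+1 (v %% n)
             else at_ m (v %/ n).+1 (v %% n))%N | v < s * n].

Definition prc c := if (c <= b)%N then c else c.-1.

Lemma prc_lt (w : 'I_(s.+1 * n)) : (prc (w %/ n) < s)%N.
Proof. by have := ord_div n_gt0 w; rewrite /prc; case: ifP; lia. Qed.

Definition pre (w : 'I_(s.+1 * n)) : 'I_(s * n) := idx (prc_lt w) (ltn_pmod w n_gt0).

(** Together with the coefficient [mcf v e j], term [j] of the expanded e-th power of the image of
    variable [v]: the binomial theorem in block [b], and only [j = 0] elsewhere. *)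
Definition mono (v : 'I_(s * n)) e j : 'X_{1..s.+1 * n} :=
  [multinom if v == pre w then
     (if w %/ n == b then e - j else if w %/ n == b.+1 then j else e)%N else 0%N | w < s.+1 * n].

Definition mcf (v : 'I_(s * n)) e j := if (v %/ n == b)%N then 'C(e, j) else (j == 0%N : nat).

Lemma pre_eq v w : (v == pre w) = ((v %/ n == prc (w %/ n)) && (v %% n == w %% n))%N.
Proof. by rewrite idx_eq idx_div idx_mod. Qed.

Lemma pval_exp (v : 'I_(s * n)) e K : (e < K)%N ->
  pval p n s b.+1 (v %/ n) (v %% n) ^+ e = \sum_(j < K) (mcf v e j)%:R *: 'X_[mono v e j].
Proof.
move=> eK; have cs := ord_div n_gt0 v; have an := ord_mod n_gt0 v.
have cs1 : (v %/ n < s.+1)%N by exact: ltnW.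
have cs2 : ((v %/ n).+1 < s.+1)%N by [].
have one c (h : (c < s.+1)%N) : (v %/ n != b)%N -> c = (if v %/ n < b then v %/ n else (v %/ n).+1)%N ->
    blk s.+1 c (v %% n) ^+ e = \sum_(j < K) (mcf v e j)%:R *: 'X_[mono v e j].
  move=> vb hc; rewrite /mcf (negbTE vb) (bigD1 (Ordinal (leq_ltn_trans (leq0n e) eK))) //=.
  rewrite big1 => [|j]; last first.
    by rewrite -val_eqE /= => /negbTE ->; rewrite scale0r.
  rewrite scale1r addr0 (blkE p h an) mpolyXn; congr 'X_[_]; apply/mnmP => w.
  rewrite mulmnE mnm1E mnmE pre_eq /prc -/(idx h an) idx_eq idx_div idx_mod hc.
  have wn := ord_div n_gt0 w; move: vb cs; move: (v %/ n)%N (w %/ n)%N wn => x y hy hx.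
  case: (v %% n == w %% n)%N; rewrite ?andbF ?mul0n // !andbT => hx'.
  by case: eqP => h1; rewrite ?mul1n ?mul0n; move: h1; do ![case: ifP]; lia.
have [h|h|h] := ltngtP (v %/ n)%N b.
- rewrite {1}/pval ifT; last by lia.
  by apply: one => //; [lia | rewrite h].
- rewrite {1}/pval ifF ?ifF; [|lia..].
  by apply: one => //; [lia | rewrite ifF //; lia].
rewrite {1}/pval ifF ?ifT; [|lia..].
rewrite exprDn (big_ord_widen K (fun i => blk s.+1 (v %/ n) (v %% n) ^+ (e - i) *
   blk s.+1 (v %/ n).+1 (v %% n) ^+ i *+ 'C(e, i))) // big_mkcond /=.
apply: eq_bigr => j _; rewrite /mcf h eqxx ltnS; case: leqP => je; last first.
  by rewrite bin_small // scale0r.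
rewrite scaler_nat; congr (_ *+ _).
rewrite -h (blkE p cs1 an) (blkE p cs2 an) !mpolyXn -mpolyXD; congr 'X_[_]; apply/mnmP => w.
rewrite mnmDE !mulmnE !mnm1E mnmE pre_eq /prc -/(idx cs1 an) -/(idx cs2 an) !idx_eq !idx_div !idx_mod.
have wn := ord_div n_gt0 w; move: h cs {one cs1 cs2}; move: (v %/ n)%N (w %/ n)%N wn => x y hy hx.
case: (v %% n == w %% n)%N; rewrite ?andbF ?mul0n // !andbT => hx'.
by case: eqP => h1; case: eqP => h2; rewrite ?mul1n ?mul0n; move: h1 h2; do ![case: ifP]; lia.
Qed.

Lemma mono_pre f u w : (\sum_v mono v (u v) (f v))%MM w =
  (if w %/ n == b then u (pre w) - f (pre w)
   else if w %/ n == b.+1 then f (pre w) else u (pre w))%N.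
Proof.
rewrite mnm_sumE (bigD1 (pre w)) //= mnmE eqxx big1 ?addn0 // => v /negbTE hv.
by rewrite mnmE hv.
Qed.

(** The exponents of [m] in block [b.+1] recover the choice [f], so at most one term of the expanded
    product hits [m]. *)
Lemma mono_eq f (u : 'X_{1..s * n}) m :
  (forall v : 'I_(s * n), (v %/ n != b)%N -> f v = 0%N) ->
  (forall v : 'I_(s * n), (v %/ n == b)%N -> f v <= u v)%N ->
  (\sum_v mono v (u v) (f v))%MM = m <->
  mg m = u /\ forall v : 'I_(s * n), (v %/ n == b)%N -> f v = at_ m b.+1 (v %% n).
Proof.
move=> f0 fu; have bs1 : (b < s.+1)%N by exact: ltnW.
split=> [E|[E Ef]].
  have Eat (w : 'I_(s.+1 * n)) : at_ m (w %/ n) (w %% n) = (if w %/ n == b then u (pre w) - f (pre w)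
   else if w %/ n == b.+1 then f (pre w) else u (pre w))%N.
    by rewrite at_ord -mono_pre E.
  have Eb1 (v : 'I_(s * n)) : (v %/ n == b)%N -> at_ m b.+1 (v %% n) = f v.
    move=> /eqP vb; have := Eat (idx (bs : (b.+1 < s.+1)%N) (ord_mod n_gt0 v)).
    rewrite idx_div idx_mod ifF ?ifT ?eqxx //; last by lia.
    move=> ->; congr (f _); apply/eqP; rewrite eq_sym pre_eq idx_div idx_mod eqxx vb /prc ifF //; lia.
  split=> [|v vb]; last by rewrite Eb1.
  apply/mnmP => v; rewrite mnmE; have cs := ord_div n_gt0 v.
  have cs1 : (v %/ n < s.+1)%N by exact: ltnW.
  case: ifP => h1.
    have := Eat (idx cs1 (ord_mod n_gt0 v)).
    rewrite idx_div idx_mod ifF ?ifF; [|lia..].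
    move=> ->; congr (u _); apply/eqP; rewrite eq_sym pre_eq idx_div idx_mod eqxx /prc ifT ?eqxx //; lia.
  case: ifP => h2.
    rewrite Eb1 //; have := Eat (idx bs1 (ord_mod n_gt0 v)).
    rewrite idx_div idx_mod eqxx => ->.
    suff -> : pre (idx bs1 (ord_mod n_gt0 v)) = v by rewrite subnK // fu.
    by apply/eqP; rewrite eq_sym pre_eq idx_div idx_mod eqxx (eqP h2) /prc leqnn eqxx.
  have := Eat (idx (cs : ((v %/ n).+1 < s.+1)%N) (ord_mod n_gt0 v)).
  rewrite idx_div idx_mod ifF ?ifF; [|lia..].
  move=> ->; congr (u _); apply/eqP; rewrite eq_sym pre_eq idx_div idx_mod eqxx /prc ifF /= ?eqxx //; lia.
apply/mnmP => w; rewrite mono_pre.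
have Eu := congr1 (fun u : 'X_{1..s * n} => u (pre w)) E; rewrite mnmE idx_div idx_mod in Eu.
have Efw := Ef (pre w); rewrite idx_div idx_mod in Efw.
rewrite -(at_ord m w) -Eu.
have wn := ord_div n_gt0 w.
move: (f (pre w)) Efw {Eu E}; move: (w %/ n)%N (w %% n)%N wn => c a cs fw.
rewrite /prc; case: (ltngtP c b) => h hf.
- by rewrite h ifF //; lia.
- case: eqP => h2; first by rewrite h2 in hf *; apply: hf.
  by rewrite ifF ?ifF ?prednK //; lia.
by rewrite h ltnn eqxx hf ?h // addnK.
Qed.

Lemma mcoeff_pface u m : (pface b.+1 'X_[u])@_m =
  ((mg m == u)%:R * (\prod_(v < s * n | (v %/ n == b)%N) 'C(u v, at_ m b.+1 (v %% n)))%:R) :> F.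
Proof.
(* One range for all exponents makes the choices a finite function type; the extra terms have
   coefficient zero. *)
pose K := (mdeg u).+1.
have uK v : (u v < K)%N by rewrite ltnS mdegE (bigD1 v) //= leq_addr.
have -> : pface b.+1 'X_[u] = \sum_(f : {ffun 'I_(s * n) -> 'I_K})
    (\prod_v mcf v (u v) (f v))%:R *: 'X_[(\sum_v mono v (u v) (f v))%MM] :> {mpoly F[s.+1 * n]}.
  rewrite /pface subX.
  under eq_bigr => v _ do rewrite (pval_exp v (uK v)).
  rewrite bigA_distr_bigA; apply: eq_bigr => f _.
  rewrite scaler_prod natr_prod; congr (_ *: _).
  by rewrite -(big_map _ xpredT (fun m => 'X_[m])) mpolyX_prod big_map.
rewrite raddf_sum /=; under eq_bigr => f _ do rewrite mcoeffZ mcoeffX.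
have nz0 (f : {ffun 'I_(s * n) -> 'I_K}) : (\prod_v mcf v (u v) (f v))%N != 0%N ->
   (forall v : 'I_(s * n), (v %/ n != b)%N -> f v = 0%N :> nat) /\
   (forall v : 'I_(s * n), (v %/ n == b)%N -> f v <= u v)%N.
  move=> h; have hv v : (mcf v (u v) (f v) != 0)%N.
    by apply: contra h => h; rewrite (bigD1 v) //= (eqP h).
  split=> v vb; have := hv v; rewrite /mcf ?vb ?(negbTE vb).
    by rewrite eqb0 negbK => /eqP.
  by rewrite -lt0n bin_gt0.
have [E|NE] := eqVneq (mg m) u; last first.
  rewrite mul0r big1 // => f _.
  have [->|/nz0[f0 fu]] := eqVneq (\prod_v mcf v (u v) (f v))%N 0%N; first by rewrite mul0r.
  case: eqP => [/(mono_eq _ f0 fu)[E]|_]; last by rewrite mulr0.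
  by rewrite E eqxx in NE.
pose g (v : 'I_(s * n)) := (if v %/ n == b then at_ m b.+1 (v %% n) else 0)%N.
have gu v : (g v <= u v)%N.
  rewrite /g; case: ifP => // /eqP vb; rewrite -E mnmE vb ltnn eqxx; exact: leq_addl.
pose f0 : {ffun 'I_(s * n) -> 'I_K} := [ffun v => inord (g v)].
have f0E v : f0 v = g v :> nat.
  by rewrite ffunE inordK // (leq_ltn_trans (gu v)).
rewrite (bigD1 f0) //= [X in _ + X]big1 ?addr0 => [|f hf].
  have -> : (\sum_v mono v (u v) (f0 v))%MM = m.
    apply/(mono_eq (f := fun v => f0 v)); [| |split=> //] => v vb; rewrite f0E //.
    - by rewrite /g (negbTE vb).
    - by rewrite /g vb.
  rewrite eqxx mulr1 mul1r; congr (_%:R); rewrite [RHS]big_mkcond /=.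
  by apply: eq_bigr => v _; rewrite /mcf f0E /g; case: (_ == b).
have [->|/nz0[h0 hu]] := eqVneq (\prod_v mcf v (u v) (f v))%N 0%N; first by rewrite mul0r.
case: eqP => [/(mono_eq _ h0 hu)[_ Ef]|_]; last by rewrite mulr0.
case/eqP: hf; apply/ffunP => v; apply: val_inj; rewrite /= f0E /g.
by case: ifP => vb; [rewrite Ef | rewrite h0 ?vb].
Qed.

End Merge.
End Coefficients.

(** * Monomials as words *)

Section Words.
Variables p n k : nat.
Hypothesis p_pr : prime p.
Hypothesis p_gt2 : (2 < p)%N.
Hypothesis n_gt0 : (0 < n)%N.
Hypothesis k_gt0 : (0 < k)%N.

Let p_gt1 : (1 < p)%N := prime_gt1 p_pr.

Local Notation F := 'F_p.
Local Notation blk s b a := (blk p s n b a).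

Definition ltr s (m : 'X_{1..s * n}) c : 'X_{1..n} := [multinom at_ m c a | a < n].
Definition wd s (m : 'X_{1..s * n}) := mkseq (ltr m) s.
Definition mk s (w : seq 'X_{1..n}) : 'X_{1..s * n} :=
  [multinom nth 0%N (nth 0%MM w (v %/ n)) (v %% n) | v < s * n].

Lemma size_wd s (m : 'X_{1..s * n}) : size (wd m) = s.
Proof. exact: size_mkseq. Qed.

Lemma nth_wd s (m : 'X_{1..s * n}) c : (c < s)%N -> nth 0%MM (wd m) c = ltr m c.
Proof. exact: nth_mkseq. Qed.

Lemma ltr_nth s (m : 'X_{1..s * n}) c a : (a < n)%N -> nth 0%N (ltr m c) a = at_ m c a.
Proof. by move=> an; rewrite -(mnm_nth 0%N _ (Ordinal an)) mnmE. Qed.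

Lemma wdK s (m : 'X_{1..s * n}) : mk s (wd m) = m.
Proof.
apply/mnmP => v; rewrite mnmE nth_wd ?ord_div // ltr_nth ?ord_mod //.
exact: at_ord.
Qed.

Lemma mkK s (w : seq 'X_{1..n}) : size w = s -> wd (mk s w) = w.
Proof.
move=> sw; apply: (@eq_from_nth _ 0%MM); rewrite size_wd // => c cs.
rewrite nth_wd //; apply/mnmP => a; rewrite mnmE /at_.
rewrite -[(c * n + a)%N]/(nat_of_ord (idx cs (ltn_ord a))) -mnm_nth mnmE.
by rewrite idx_div // idx_mod -mnm_nth.
Qed.

Lemma wd_inj s : injective (@wd s).
Proof. by move=> m m' /(congr1 (mk s)); rewrite !wdK. Qed.

Lemma sum_blocks s (G : nat -> nat -> nat) :
  (\sum_(v < s * n) G (v %/ n) (v %% n) = \sum_(c < s) \sum_(a < n) G c a)%N.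
Proof.
rewrite -(big_mkord xpredT (fun v => G (v %/ n) (v %% n))%N).
elim: s => [|s IH]; first by rewrite mul0n big_nil big_ord0.
rewrite big_ord_recr /= -IH mulSnr (big_cat_nat (n := (s * n)%N)) ?leq_addr //=.
congr (_ + _)%N; rewrite -{1}[(s * n)%N]add0n big_addn addKn big_mkord.
apply: eq_bigr => a _; rewrite addnC divnMDl // divn_small // addn0.
by rewrite modnMDl modn_small.
Qed.

Lemma sum_wd s (m : 'X_{1..s * n}) (G : 'X_{1..n} -> nat) :
  (\sum_(b <- wd m) G b = \sum_(c < s) G (ltr m c))%N.
Proof. by rewrite big_map -(big_mkord xpredT (fun c => G (ltr m c))) /index_iota subn0. Qed.

Lemma mwt_wd s (m : 'X_{1..s * n}) : mwt p (om k (s := s)) m = (\sum_(b <- wd m) lwt p k b)%N.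
Proof.
rewrite sum_wd.
pose G c a := ((2 * (k + a) - 1) * digsum p (at_ m c a))%N.
transitivity (\sum_(v < s * n) G (v %/ n) (v %% n))%N.
  by apply: eq_bigr => v _; rewrite /G at_ord.
rewrite sum_blocks; apply: eq_bigr => c _; apply: eq_bigr => a _.
by rewrite mnmE.
Qed.

Lemma mdg_wd s (m : 'X_{1..s * n}) :
  mdg (dl p k (s := s)) m = (2 * (p - 1) * \sum_(b <- wd m) ldeg p k b)%N.
Proof.
rewrite sum_wd.
pose G c a := (at_ m c a * (2 * ((p - 1) * repunit p (k + a))))%N.
transitivity (\sum_(v < s * n) G (v %/ n) (v %% n))%N.
  by apply: eq_bigr => v _; rewrite /G at_ord repunit_pred.
rewrite sum_blocks big_distrr; apply: eq_bigr => c _ /=; rewrite /ldeg big_distrr.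
apply: eq_bigr => a _ /=.
by rewrite /G mnmE; lia.
Qed.

Lemma nz_wd s (m : 'X_{1..s * n}) : nz (wd m) <->
  forall b, (b < s)%N -> exists v : 'I_(s * n), ((v %/ n)%N == b) && (0 < m v)%N.
Proof.
split=> [/all_nthP h b bs|h].
  have := h 0%MM b; rewrite size_wd nth_wd // => /(_ bs) hb.
  have [a ha] : exists a : 'I_n, (0 < ltr m b a)%N.
    apply/existsP; apply: contraNT hb; rewrite negb_exists => /forallP hb.
    by apply/eqP/mnmP => a; rewrite mnm0E; have := hb a; rewrite -eqn0Ngt => /eqP.
  exists (idx bs (ltn_ord a)); rewrite idx_div // eqxx /=.
  by move: ha; rewrite mnmE /at_ (mnm_nth 0%N).
apply/(all_nthP 0%MM) => c; rewrite size_wd => cs; rewrite nth_wd //.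
have [v /andP[/eqP vc]] := h c cs; rewrite -at_ord // vc => hv.
apply: contraTneq hv => E.
by rewrite -ltr_nth ?ord_mod // E -(mnm_nth 0%N _ (gix n_gt0 v)) mnm0E.
Qed.

Lemma normalized_wd s (z : {mpoly F[s * n]}) :
  normalized p s n z <-> forall m, m \in msupp z -> nz (wd m).
Proof. by split=> h m hm; apply/nz_wd; apply: h. Qed.

Definition smerge b (w : seq 'X_{1..n}) :=
  take b w ++ (nth 0 w b + nth 0 w b.+1)%MM :: drop b.+2 w.

Lemma size_smerge b w : (b.+1 < size w)%N -> (size (smerge b w)).+1 = size w.
Proof. by move=> h; rewrite size_cat /= size_drop size_takel //; lia. Qed.

Lemma nth_smerge b w c : (b.+1 < size w)%N -> nth 0%MM (smerge b w) c =
  if (c < b)%N then nth 0%MM w c else if c == b then (nth 0 w b + nth 0 w b.+1)%MM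
  else nth 0%MM w c.+1.
Proof.
move=> h; rewrite nth_cat size_takel; last by lia.
case: ltngtP => hc; first by rewrite nth_take.
  have -> : (c - b = (c - b.+1).+1)%N by lia.
  by rewrite /= nth_drop; congr (nth _ _ _); lia.
by rewrite hc subnn.
Qed.

Lemma splitsP u v : splits p u v <-> exists b, [/\ (b.+1 < size v)%N, u = smerge b v,
  nth 0%MM v b != 0%MM, nth 0%MM v b.+1 != 0%MM & legal p (nth 0%MM v b) (nth 0%MM v b.+1)].
Proof.
split=> [|[b []]].
  elim=> [c d w c0 d0 L|c u' v' _ [b [h1 -> h3 h4 h5]]].
    by exists 0%N; split=> //; rewrite /smerge /= drop0.
  by exists b.+1; split.
elim: b u v => [|b IH] u v.
  case: v => [|c [|d w]] //= _ ->; rewrite /smerge /= drop0; exact: SplitHere.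
case: v => [|c v] //= h -> h1 h2 h3; rewrite /smerge /=; apply: SplitNext.
exact: IH.
Qed.

(** At the smaller index one merge shows a sum of two letters and the other only the first of them,
    while letters are nonzero. Different faces therefore never cancel. *)
Lemma smerge_inj b b' w : nz w -> (b.+1 < size w)%N -> (b'.+1 < size w)%N ->
  smerge b w = smerge b' w -> b = b'.
Proof.
move=> nw; wlog lt : b b' / (b < b')%N => [hw|] h h' E.
  case: (ltngtP b b') => // lt; first exact: hw.
  by apply/esym; apply: hw.
have := congr1 (fun w => nth 0%MM w b) E.
rewrite !nth_smerge // ltnn eqxx lt => /eqP.
rewrite -[X in _ == X]addm0 eqm_add2l => /eqP E0.
by have := all_nthP 0%MM nw _ h; rewrite E0 eqxx.
Qed.

Lemma wd_mg s b (m : 'X_{1..s.+1 * n}) : (b < s)%N -> wd (mg b m) = smerge b (wd m).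
Proof.
move=> bs; have sz : (b.+1 < size (wd m))%N by rewrite size_wd.
apply: (@eq_from_nth _ 0%MM).
  by apply: succn_inj; rewrite size_smerge // !size_wd.
rewrite size_wd => c cs; rewrite nth_smerge // nth_wd // !nth_wd //; try lia.
apply/mnmP => a; rewrite mnmE /at_.
rewrite -[(c * n + a)%N]/(nat_of_ord (idx cs (ltn_ord a))) -mnm_nth mnmE.
rewrite idx_div // idx_mod.
by case: ltngtP => // hc; rewrite ?hc ?mnmDE !mnmE.
Qed.

Lemma mcoeff_avoid s i (u : 'X_{1..s * n}) (m : 'X_{1..s.+1 * n}) c :
  (c < s.+1)%N -> nz (wd m) ->
  (forall b a, (b < s)%N -> exists2 c', (c' < s.+1)%N && (c' != c) &
     pval p n s i b a = blk s.+1 c' a) ->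
  (pface i 'X_[u] : {mpoly F[s.+1 * n]})@_m = 0.
Proof.
move=> cs /nz_wd /(_ c cs)[w /andP[/eqP wc mw]] h; apply/eqP; rewrite mcoeff_eq0.
(* A grading that counts the exponent of the single variable [w] in block [c]: the face has degree
   0, while [m] has positive degree. *)
pose D (v : 'I_(s.+1 * n)) := (v == w : nat).
have hm : homg D 0 (pface i 'X_[u] : {mpoly F[s.+1 * n]}).
  rewrite /pface; apply: (@homg_sub _ _ _ _ (fun=> 0%N)) => [v|].
    have an := ord_mod n_gt0 v.
    have [c' /andP[c's c'c] ->] := h (v %/ n)%N (v %% n)%N (ord_div n_gt0 v).
    rewrite (blkE p c's an).
    have -> : 0%N = mdg D U_(Ordinal (blk_ltn c's an)).
      rewrite /mdg big1 // => x _; rewrite mnm1E /D.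
      case: (x =P w) => [->|]; last by rewrite muln0.
      rewrite -/(idx c's an) idx_eq idx_div // wc (negbTE c'c) //.
    exact: homgX.
  move=> m' _; rewrite /mdg big1 // => x _; exact: muln0.
apply/negP => /hm; rewrite /mdg (bigD1 w) //= /D eqxx muln1.
by move: mw; lia.
Qed.

(** The outer faces [0] and [s.+1] insert a constant factor, so they contribute nothing at a
    normalized monomial. *)
Lemma mcoeff_pd s (u : 'X_{1..s * n}) (m : 'X_{1..s.+1 * n}) : nz (wd m) ->
  (pd 'X_[u] : {mpoly F[s.+1 * n]})@_m =
  \sum_(b < s) (-1) ^+ b.+1 * (pface b.+1 'X_[u] : {mpoly F[s.+1 * n]})@_m.
Proof.
move=> nm; rewrite /pd raddf_sum /=; under eq_bigr do rewrite mcoeffZ.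
pose K i := (pface i 'X_[u] : {mpoly F[s.+1 * n]})@_m.
have K0 : K 0%N = 0.
  apply: (@mcoeff_avoid _ _ _ _ 0%N) => // b a bs.
  by exists b.+1; rewrite ?ltnS ?bs.
have Ks : K s.+1 = 0.
  apply: (@mcoeff_avoid _ _ _ _ s) => // b a bs.
  by exists b; [lia | rewrite /pval ltnS bs].
rewrite -[LHS]/(\sum_(i < s.+2) (-1) ^+ i * K i).
rewrite -[RHS]/(\sum_(b < s) (-1) ^+ b.+1 * K b.+1).
clearbody K; rewrite big_ord_recr big_ord_recl /= K0 Ks !mulr0 add0r addr0.
by apply: eq_bigr.
Qed.

Lemma mcoeff_pd_neq0 s (u : 'X_{1..s * n}) (m : 'X_{1..s.+1 * n}) : nz (wd m) ->
  mwt p (om k (s := s.+1)) m = mwt p (om k (s := s)) u ->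
  (pd 'X_[u] : {mpoly F[s.+1 * n]})@_m != 0 -> splits p (wd u) (wd m).
Proof.
move=> nm Ew; rewrite mcoeff_pd // => hne.
have [b hb] : exists b : 'I_s, mg b m == u.
  apply/existsP; apply: contraNT hne; rewrite negb_exists => /forallP h.
  by rewrite big1 // => b _; rewrite mcoeff_pface // (negbTE (h b)) mul0r mulr0.
have bs := ltn_ord b; have sz : (b.+1 < size (wd m))%N by rewrite size_wd.
apply/splitsP; exists b.
have Eu : wd u = smerge b (wd m) by rewrite -(eqP hb) wd_mg.
have nn c := all_nthP 0%MM nm c.
split=> //; [by apply: nn; exact: ltnW | exact: nn |].
apply/(lwt_legal p_gt2 n_gt0 k_gt0); move: Ew; rewrite !mwt_wd Eu.
rewrite -{1}(cat_take_drop b (wd m)) (drop_nth 0%MM (ltnW sz)) (drop_nth 0%MM sz).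
by rewrite /smerge !big_cat !big_cons /= => /eqP; rewrite eqn_add2l addnA eqn_add2r => /eqP/esym.
Qed.

(** By [smerge_inj] a single face contributes, and by [nocarry_bin] its product of binomials is
    prime to [p]. This makes matched coefficients invertible. *)
Lemma mcoeff_pd_splits s (u : 'X_{1..s * n}) (m : 'X_{1..s.+1 * n}) : nz (wd m) ->
  splits p (wd u) (wd m) -> (pd 'X_[u] : {mpoly F[s.+1 * n]})@_m != 0.
Proof.
move=> nm /splitsP[b [h1 h2 h3 h4 L]]; rewrite mcoeff_pd //.
have bs : (b < s)%N by move: h1; rewrite size_wd.
have Eu : mg b m = u by apply: wd_inj; rewrite wd_mg.
rewrite (bigD1 (Ordinal bs)) //= big1 ?addr0 => [|b' hb']; last first.
  rewrite mcoeff_pface //; case: eqP => [E|]; last by rewrite mul0r mulr0.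
  case/eqP: hb'; apply: val_inj => /=; apply: (smerge_inj nm) => //.
    by rewrite size_wd ltnS.
  by rewrite -!wd_mg // E Eu.
rewrite mulf_neq0 ?signr_eq0 // mcoeff_pface // Eu eqxx mul1r.
rewrite natr_prod; apply/prodf_neq0 => v /eqP vb.
rewrite -(dvdn_pcharf (pchar_Fp p_pr)).
have -> : u v = (at_ m b.+1 (v %% n) + at_ m b (v %% n))%N.
  by rewrite -Eu mnmE vb ltnn eqxx addnC.
apply: nocarry_bin => // l; have := L (gix n_gt0 v) l.
rewrite !nth_wd // /ltr ?mnmE; last exact: ltnW.
by rewrite addnC.
Qed.

End Words.

(** * Vanishing of E_1 *)

Section Vanishing.
Variables p n k c : nat.
Hypothesis p_pr : prime p.
Hypothesis p_gt2 : (2 < p)%N.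
Hypothesis n_gt0 : (0 < n)%N.
Hypothesis k_gt0 : (0 < k)%N.

Let p_gt1 : (1 < p)%N := prime_gt1 p_pr.

Local Notation F := 'F_p.
Local Notation d s z := (dcob p n (copT p n k) s z).
Local Notation omT s := (@om n k s).
Local Notation dlT s := (@dl p n k s).
Local Notation T := (2 * (p - 1) * c)%N.
Local Notation wt m := (mwt p (omT _) m).
Local Notation deg m := (mdg (dlT _) m).
Local Notation K := (n * T.+1)%N.
Local Notation typ := (typ p None).
Local Notation mu := (mu p None).
Local Notation nu := (nu p None).

Lemma splits_sumlwt (u v : seq 'X_{1..n}) : splits p u v ->
  (\sum_(b <- u) lwt p k b = \sum_(b <- v) lwt p k b)%N.
Proof.
elim=> [x y w _ _ L|b u' v' _ IH]; rewrite !big_cons; last by rewrite IH.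
by rewrite (iffLR (lwt_legal p_gt2 n_gt0 k_gt0 _ _) L) addnA.
Qed.

Lemma splits_sumldeg (u v : seq 'X_{1..n}) : splits p u v ->
  (\sum_(b <- u) ldeg p k b = \sum_(b <- v) ldeg p k b)%N.
Proof.
elim=> [x y w _ _ L|b u' v' _ IH]; rewrite !big_cons; last by rewrite IH.
by rewrite ldegD // addnA.
Qed.

Lemma splits_wt s (u : 'X_{1..s * n}) (m : 'X_{1..s.+1 * n}) :
  splits p (wd u) (wd m) -> wt u = wt m.
Proof. by move=> h; rewrite !mwt_wd // (splits_sumlwt h). Qed.

Lemma splits_deg s (u : 'X_{1..s * n}) (m : 'X_{1..s.+1 * n}) :
  splits p (wd u) (wd m) -> deg u = deg m.
Proof. by move=> h; rewrite !mdg_wd // (splits_sumldeg h). Qed.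

Lemma noncritical s (m : 'X_{1..s * n}) : nz (wd m) -> deg m = T ->
  (wt m + s < 2 * digsum p c)%N -> typ (wd m) != None.
Proof.
move=> nm dm hw; apply/eqP => h.
have := critical_bound p_gt2 n_gt0 k_gt0 nm h.
rewrite /pend ldeg0 lwt0 !addn0 size_wd -mwt_wd //.
suff -> : (\sum_(b <- wd m) ldeg p k b = c)%N by lia.
move: dm; rewrite mdg_wd // => /eqP; rewrite eqn_mul2l => /orP[|/eqP //].
by rewrite muln_eq0 subn_eq0 leqNgt p_gt1.
Qed.

Lemma exp_le_deg s (m : 'X_{1..s * n}) v : (m v <= m v * dlT s v)%N.
Proof.
rewrite leq_pmulr // /dl muln_gt0 /= subn_gt0 -(expn0 p) ltn_exp2l //.
by rewrite addn_gt0 k_gt0.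
Qed.

Lemma mdeg_le_deg s (m : 'X_{1..s * n}) : (mdeg m <= deg m)%N.
Proof. by rewrite mdegE; apply: leq_sum => v _; exact: exp_le_deg. Qed.

(** The origin of [K]: exponents are at most [T], and a generator coded by [n * T.+1] or more refers
    to a digit at a place above [T], which is zero. *)
Lemma bounded_wd s (m : 'X_{1..s * n}) b : deg m = T -> b \in wd m -> bounded p K b.
Proof.
move=> dm /mapP[x]; rewrite mem_iota add0n => /andP[_ xs] -> y hy.
rewrite (cntE _ n_gt0); apply: digit_big.
set e := (X in (X < _)%N); have le : (e <= T)%N.
  rewrite /e mnmE /at_ -[(x * n + _)%N]/(nat_of_ord (idx xs (ltn_ord (gix n_gt0 y)))).
  rewrite -mnm_nth -dm; apply: leq_trans (exp_le_deg m _) _.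
  by rewrite /mdg (bigD1 (idx xs (ltn_ord (gix n_gt0 y)))) //= leq_addr.
apply: leq_ltn_trans le _; apply: (@leq_trans (y %/ n)); last first.
  exact: ltnW (ltn_expl _ p_gt1).
by rewrite leq_divRL // mulnC.
Qed.

Section Potential.
Variable s : nat.
Implicit Types u : 'X_{1..s * n}.

(* Packs the lexicographic order (inversions up, moment down) into one number. *)
Definition mbound := (\max_(b : bmultinom (s * n) T.+1) moment (wd (b : 'X_{1..s * n})))%N.
Definition pot (u : 'X_{1..s * n}) := (winv p K (wd u) * mbound.+1 + (mbound - moment (wd u)))%N.

Lemma moment_le u : deg u = T -> (moment (wd u) <= mbound)%N.
Proof.
move=> du; have lt : (mdeg u < T.+1)%N by rewrite ltnS -du mdeg_le_deg.
exact: (leq_bigmax (BMultinom lt)).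
Qed.

Lemma pot_lt (u u' : 'X_{1..s * n}) : deg u = T -> deg u' = T ->
  (winv p K (wd u) < winv p K (wd u'))%N \/
  winv p K (wd u) = winv p K (wd u') /\ (moment (wd u') < moment (wd u))%N ->
  (pot u < pot u')%N.
Proof.
move=> /moment_le h /moment_le h' [lt|[E lt]]; rewrite /pot; last by rewrite E; lia.
have := leq_mul2r mbound.+1 (winv p K (wd u)).+1 (winv p K (wd u')).
rewrite lt orbT mulSn; lia.
Qed.

Definition pbound := (\max_(b : bmultinom (s * n) T.+1) pot b)%N.

Lemma pot_le u : deg u = T -> (pot u <= pbound)%N.
Proof.
move=> du; have lt : (mdeg u < T.+1)%N by rewrite ltnS -du mdeg_le_deg.
exact: (leq_bigmax (BMultinom lt)).
Qed.

Lemma acyclic_mon (u u' : 'X_{1..s * n}) (m : 'X_{1..s.+1 * n}) :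
  typ (wd u) = Some true -> typ (wd u') = Some true -> nz (wd u) -> nz (wd u') ->
  deg u = T -> deg u' = T -> wd m = mu (wd u') -> splits p (wd u) (wd m) ->
  u = u' \/ (pot u < pot u')%N.
Proof.
move=> tu tu' nu nu' du du' Em S.
have bnd b : b \in wd u -> bounded p K b by exact: bounded_wd.
have := acyclic p_gt2 n_gt0 S Em tu tu' nu nu' bnd.
case=> [/(wd_inj n_gt0) ->|h|h]; first by left.
  by right; apply: pot_lt => //; left.
by right; apply: pot_lt => //; right.
Qed.

Lemma pd_sum (I : Type) (r : seq I) (P : pred I) (a : I -> F) (f : I -> 'X_{1..s * n}) :
  pd (\sum_(i <- r | P i) a i *: 'X_[f i]) =
  \sum_(i <- r | P i) a i *: pd 'X_[f i] :> {mpoly F[s.+1 * n]}.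
Proof.
rewrite /pd.
transitivity (\sum_(j < s.+2) \sum_(i <- r | P i)
    a i *: ((-1) ^+ j *: (pface j 'X_[f i] : {mpoly F[s.+1 * n]}))).
  apply: eq_bigr => j _; rewrite {1}/pface sub_sum scaler_sumr.
  by apply: eq_bigr => i _; rewrite !scalerA mulrC.
rewrite exchange_big; apply: eq_bigr => i _; exact/esym/scaler_sumr.
Qed.

Lemma mcoeff_pdE (z : {mpoly F[s * n]}) m :
  (pd z)@_m = \sum_(u <- msupp z) z@_u * (pd 'X_[u] : {mpoly F[s.+1 * n]})@_m.
Proof.
rewrite {1}(mpolyE z) pd_sum; rewrite (raddf_sum (mcoeff m)) /=.
by apply: eq_bigr => u _; rewrite mcoeffZ.
Qed.

Lemma bd_pd M r (z : {mpoly F[s * n]}) : bd (omT s) M r z -> bd (omT s.+1) M r (pd z).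
Proof.
move=> h; rewrite /pd; apply: bd_sum => i _ _; apply: bdZ.
rewrite /pface; apply: bd_sub h => // v.
by have [] := cong_fval p_pr n_gt0 k_gt0 i v.
Qed.

Lemma mcoeff_pd_splits_wt u (m : 'X_{1..s.+1 * n}) : nz (wd m) -> (wt u <= wt m)%N ->
  (pd 'X_[u] : {mpoly F[s.+1 * n]})@_m != 0 -> splits p (wd u) (wd m).
Proof.
move=> nm le hne; apply: (mcoeff_pd_neq0 p_pr p_gt2 n_gt0 k_gt0) => //.
have : bd (omT s) (wt u) 0 ('X_[u] : {mpoly F[s * n]}) by apply: bdX; rewrite addn0.
move=> /bd_pd/(_ m); rewrite mcoeff_msupp addn0 => /(_ hne) ge.
by apply/eqP; rewrite eqn_leq ge le.
Qed.

(** Triangularity: the coefficient of [d s z] at [mu] of a word [u] of weight [M] involves, besides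
    [u], only words of smaller potential. By induction these are absent, and the coefficient of [u]
    itself is invertible, so [u] cannot occur. *)
Lemma vanish_inj M (z : {mpoly F[s * n]}) :
  normalized p s n z -> homg (dlT s) T z -> bd (omT s) M 0 z -> bd (omT s.+1) M 1 (d s z) ->
  (forall m, m \in msupp z -> wt m = M -> typ (wd m) = Some true) ->
  bd (omT s) M 1 z.
Proof.
move=> /(normalized_wd n_gt0) hn hz bz bdz hA.
have H N u : u \in msupp z -> wt u = M -> (pot u < N)%N -> False.
  elim: N u => // N IH u hu wu hN.
  have tu := hA u hu wu; have nu := hn u hu; have du := hz u hu.
  have S := mu_splits p_gt2 n_gt0 nu tu.
  have Em : wd (mk s.+1 (mu (wd u))) = mu (wd u).
    by apply: mkK; rewrite // (splits_size S) size_wd.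
  set m := mk _ _ in Em.
  have S' : splits p (wd u) (wd m) by rewrite Em.
  have wm := splits_wt S'; have nm : nz (wd m) by rewrite -(splits_nz S').
  have : (d s z)@_m = 0.
    by apply/eqP; rewrite mcoeff_eq0; apply/negP => /bdz; lia.
  rewrite (mcoeff_dcob p_pr n_gt0 k_gt0 bz); last by rewrite -wm wu.
  rewrite mcoeff_pdE (bigD1_seq u hu (msupp_uniq z)) /=.
  rewrite big_seq_cond big1 ?addr0 => [|u2 /andP[hu2 ne]].
    move=> /eqP; rewrite mulf_eq0 mcoeff_eq0 hu /=.
    by rewrite (negbTE (mcoeff_pd_splits p_pr p_gt2 n_gt0 k_gt0 nm S')).
  apply/eqP; apply: contraNT ne => hne.
  have hne2 : (pd 'X_[u2] : {mpoly F[s.+1 * n]})@_m != 0.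
    by apply: contraNneq hne => ->; rewrite mulr0.
  have le2 : (wt u2 <= M)%N by have := bz u2 hu2; rewrite addn0.
  have S2 : splits p (wd u2) (wd m).
    by apply: mcoeff_pd_splits_wt => //; rewrite -wm wu.
  have wu2 : wt u2 = M by rewrite (splits_wt S2) -wm.
  have [->//|lt] := acyclic_mon (hA _ hu2 wu2) tu (hn _ hu2) nu (hz _ hu2) du Em S2.
  exact: False_ind _ (IH u2 hu2 wu2 (leq_trans lt hN)).
move=> m hm; rewrite addn1; have := bz m hm; rewrite addn0 leq_eqVlt => /orP[/eqP wm|//].
exact: False_ind _ (H _ m hm wm (ltnSn _)).
Qed.

End Potential.

(** * Elimination of the words that are to be merged *)

Section Eliminate.
Variables (s M : nat).

Definition num (m : 'X_{1..s.+1 * n}) : 'X_{1..s * n} := mk s (nu (wd m)).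

Lemma num_spec (m : 'X_{1..s.+1 * n}) : nz (wd m) -> typ (wd m) = Some false ->
  [/\ typ (wd (num m)) = Some true, wd m = mu (wd (num m)), nz (wd (num m))
    & splits p (wd (num m)) (wd m)].
Proof.
move=> nm tm; have [t1 t2 t3] := nu_spec0 p_gt2 n_gt0 nm tm.
have S := mu_splits p_gt2 n_gt0 t3 t1; rewrite t2 in S.
have E : wd (num m) = nu (wd m).
  by apply: mkK => //; have := splits_size S; rewrite size_wd => -[].
by rewrite E; split.
Qed.

(* The coboundaries subtracted at stage N only create new merged words of larger
   potential. *)
Lemma eliminate_B (z : {mpoly F[s.+1 * n]}) N :
  normalized p s.+1 n z -> homg (dlT s.+1) T z -> bd (omT s.+1) M 0 z ->
  exists w : {mpoly F[s * n]}, [/\ normalized p s n w, homg (dlT s) T w, bd (omT s) M 0 w &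
    forall m, m \in msupp (z - d s w) -> wt m = M -> typ (wd m) = Some false ->
      (N <= pot (num m))%N].
Proof.
move=> hn hz bz; elim: N => [|N [w [nw hw bw IH]]].
  exists 0; split=> //; [by move=> m; rewrite msupp0 | exact: homg0 | exact: bd0].
set z' := z - d s w in IH.
have hz' : homg (dlT s.+1) T z' by apply: homgB => //; exact: homg_dcob.
have nz' m : m \in msupp z' -> nz (wd m).
  move=> /msuppB_le; rewrite mem_cat => /orP[]; first exact: (iffLR (normalized_wd n_gt0 _) hn).
  exact: (iffLR (normalized_wd n_gt0 _) (normalized_dcob p_pr n_gt0 k_gt0 nw)).
pose P m := [&& wt m == M, typ (wd m) == Some false & pot (num m) == N].
pose D u m := (pd 'X_[u] : {mpoly F[s.+1 * n]})@_m.
have sp m : m \in msupp z' -> P m -> [/\ typ (wd (num m)) = Some true, wd m = mu (wd (num m)),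
   nz (wd (num m)), splits p (wd (num m)) (wd m) & wt m = M].
  move=> hm /and3P[/eqP wm /eqP tm _].
  by have [] := num_spec (nz' m hm) tm; split.
(* Each remaining word whose partner has potential [N] is removed by that partner; the division
   makes its coefficient cancel exactly. *)
pose w2 : {mpoly F[s * n]} :=
  \sum_(m <- msupp z' | P m) (z'@_m / D (num m) m) *: 'X_[num m].
have supp2 u : u \in msupp w2 -> exists2 m, (m \in msupp z') && P m & u = num m.
  rewrite /w2 => /msupp_sum_le /flattenP[l] /mapP[m].
  rewrite mem_filter => /andP[Pm hm] -> /msuppZ_le; rewrite msuppX inE => /eqP ->.
  by exists m; rewrite ?hm.
have nw2 u : u \in msupp w2 -> nz (wd u).
  by move=> /supp2[m /andP[hm Pm] ->]; have [] := sp m hm Pm.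
have hw2 : homg (dlT s) T w2.
  move=> u /supp2[m /andP[hm Pm] ->]; have [_ _ _ S _] := sp m hm Pm.
  by rewrite (splits_deg S) hz'.
have bw2 : bd (omT s) M 0 w2.
  move=> u /supp2[m /andP[hm Pm] ->]; have [_ _ _ S wm] := sp m hm Pm.
  by rewrite (splits_wt S) wm addn0.
exists (w + w2); split.
- apply/(normalized_wd n_gt0) => u /msuppD_le; rewrite mem_cat => /orP[|/nw2 //].
  exact: (iffLR (normalized_wd n_gt0 _) nw).
- exact: homgD.
- exact: bdD.
rewrite dcobD opprD addrA -/z' => m hm wm tm.
rewrite leqNgt; apply/negP => lt.
have nm : nz (wd m).
  move: hm => /msuppB_le; rewrite mem_cat => /orP[/nz' //|].
  apply: (iffLR (normalized_wd n_gt0 _)); apply: (normalized_dcob p_pr n_gt0 k_gt0).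
  exact: (iffRL (normalized_wd n_gt0 _)).
have hm' : deg m = T.
  by move: m hm {wm tm lt nm}; apply: homgB => //; exact: homg_dcob.
have [t1 t2 t3 S] := num_spec nm tm.
move: hm; rewrite mcoeff_msupp mcoeffB => /negP; apply; apply/eqP.
rewrite (mcoeff_dcob p_pr n_gt0 k_gt0 bw2) ?wm //.
have -> : (pd w2)@_m = \sum_(m2 <- msupp z' | P m2) (z'@_m2 / D (num m2) m2) * D (num m2) m.
  rewrite /w2 pd_sum (raddf_sum (mcoeff m)) /=.
  by apply: eq_bigr => u _; rewrite mcoeffZ.
(* Partners of one stage do not interfere: by acyclicity another partner reaching [m] would have
   potential [N] strictly below that of [num m], against [lt]. *)
have off m2 : m2 \in msupp z' -> P m2 -> m2 != m -> D (num m2) m = 0.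
  move=> hm2 Pm2 ne; apply/eqP; apply: contraNT ne => hD.
  have [s1 s2 s3 s4 wm2] := sp m2 hm2 Pm2.
  have S2 : splits p (wd (num m2)) (wd m).
    by apply: mcoeff_pd_splits_wt => //; rewrite (splits_wt s4) wm2 wm.
  have d2 : deg (num m2) = T by rewrite (splits_deg s4) hz'.
  have d1 : deg (num m) = T by rewrite (splits_deg S).
  have [E|lt2] := acyclic_mon s1 t1 s3 t3 d2 d1 t2 S2.
    by apply/eqP; apply: (wd_inj n_gt0); rewrite t2 s2 E.
  by case/and3P: Pm2 => _ _ /eqP E; move: lt lt2; rewrite E; lia.
have [hm2|hm2] := boolP (m \in msupp z'); last first.
  have -> : z'@_m = 0 by apply/eqP; rewrite mcoeff_eq0.
  rewrite big_seq_cond big1 ?subrr // => m2 /andP[h1 h2].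
  rewrite off ?mulr0 //; apply: contraNneq hm2 => <- //.
have Pm : P m.
  rewrite /P wm eqxx tm eqxx /=; have := IH m hm2 wm tm; move: lt; rewrite ltnS => l1 l2.
  by rewrite eqn_leq l1 l2.
rewrite big_mkcond /= (bigD1_seq m hm2 (msupp_uniq z')) /=.
rewrite Pm [X in _ - (_ + X)]big_seq_cond [X in _ - (_ + X)]big1 => [|m2 /andP[h1 h2]]; last first.
  by case: ifP => // Pm2; rewrite off ?mulr0.
have D0 : D (num m) m != 0 by exact: (mcoeff_pd_splits p_pr p_gt2 n_gt0 k_gt0).
by move: (D (num m) m) D0 => x x0; rewrite divfK // addr0 subrr.
Qed.

End Eliminate.

(** Below the line no word is critical, and past the largest potential no word to be merged is left
    in weight [M]. So [vanish_inj] applies to [z - d s w], which has the same coboundary as [z]. *)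
Theorem vanishing s M (z : {mpoly F[s * n]}) : (M + s < 2 * digsum p c)%N ->
  normalized p s n z -> homg (dlT s) T z -> bd (omT s) M 0 z -> bd (omT s.+1) M 1 (d s z) ->
  sameE1 p (Tcx p n k T) M s z 0.
Proof.
move=> hM; have tA m : nz (wd m) -> deg m = T -> wt m = M -> typ (wd m) <> Some false ->
    typ (wd (m : 'X_{1..s * n})) = Some true.
  move=> nm dm wm; have := noncritical nm dm; rewrite wm => /(_ hM).
  by case: (typ _) => [[]|].
case: s z hM tA => [|s] z hM tA hn hz bz bdz.
  rewrite /= subr0; apply: vanish_inj => // m hm wm; apply: tA => //.
  exact: hz.
have [w [nw hw bw H]] := eliminate_B (pbound s).+1 hn hz bz.
exists w; split; first by split.
split=> //; rewrite subr0.
have nz' : normalized p s.+1 n (z - d s w).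
  apply/(normalized_wd n_gt0) => m /msuppB_le; rewrite mem_cat => /orP[].
    exact: (iffLR (normalized_wd n_gt0 _) hn).
  exact: (iffLR (normalized_wd n_gt0 _) (normalized_dcob p_pr n_gt0 k_gt0 nw)).
have hz' : homg (dlT s.+1) T (z - d s w) by apply: homgB => //; exact: homg_dcob.
apply: (vanish_inj nz' hz').
- by apply: bdB; [exact: bz | exact: bd_dcob].
- by rewrite dcobB (dcob_dcob _ p_pr n_gt0) subr0.
move=> m hm wm; have nm := iffLR (normalized_wd n_gt0 _) nz' m hm.
have dm := hz' m hm; apply: tA => // tm.
have [t1 t2 t3 S] := num_spec nm tm.
have := H m hm wm tm; rewrite ltnNge; apply/negP; rewrite negbK.
by apply: pot_le; rewrite (splits_deg S).
Qed.

End Vanishing.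

(** * Passage to S(n,k) and survival *)

Local Opaque mpolyX.

(** * Exponents modulo t^(p^n) = t *)

Section ReducedExponents.
Local Open Scope nat_scope.
Variables p n : nat.
Hypothesis p_gt1 : 1 < p.
Hypothesis n_gt0 : 0 < n.
Local Notation P := (p ^ n).
Local Notation red := (redexp p n).

Lemma expn_ge2 : 1 < P.
Proof. by rewrite -(expn0 p) ltn_exp2l. Qed.

Lemma redexp0 : red 0 = 0. Proof. by []. Qed.

Lemma redexpS e : red e.+1 = (e %% P.-1).+1. Proof. by []. Qed.

Lemma redexp_gt0 e : (0 < red e) = (0 < e). Proof. by case: e. Qed.

Lemma redexp_lt e : red e < P.
Proof.
have h := expn_ge2; case: e => [|e]; first by rewrite redexp0 ltnW.
rewrite redexpS; have : e %% P.-1 < P.-1 by apply: ltn_pmod; lia.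
lia.
Qed.

Lemma redexp_small e : e < P -> red e = e.
Proof. by case: e => // e h; rewrite redexpS modn_small //; lia. Qed.

Lemma redexpMD q e : 0 < e -> red (q * P.-1 + e) = red e.
Proof. by case: e => // e _; rewrite addnS !redexpS modnMDl. Qed.

Lemma redexpD e f : red (red e + red f) = red (e + f).
Proof.
case: e => [|e]; first by rewrite !add0n redexp_small // redexp_lt.
case: f => [|f]; first by rewrite !addn0 redexp_small // redexp_lt.
have E x y : red (x.+1 + y.+1) = ((x + y + 1) %% P.-1).+1 by rewrite addnS addSn redexpS addn1.
by rewrite (redexpS e) (redexpS f) !E; congr _.+1; rewrite -modnDml modnDm modnDml.
Qed.

Lemma redexpM e : red (P * e) = red e.
Proof.
case: e => [|e]; first by rewrite muln0.
rewrite -(@redexpMD e.+1 e.+1) //; congr red.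
by have := expn_ge2; case: P => // q _; rewrite /= mulSn mulnC addnC.
Qed.

Lemma digsum_expMD m q r : r < p ^ m -> digsum p (p ^ m * q + r) = digsum p q + digsum p r.
Proof.
elim: m q r => [|m IH] q r; first by rewrite expn0 mul1n ltnS leqn0 => /eqP->; rewrite digsum0 !addn0.
move=> h; rewrite (digsum_rec p_gt1 r) (digsum_rec p_gt1 (_ + _)) expnS -mulnA.
have lt : r %/ p < p ^ m by rewrite ltn_divLR -?expnSr // ltnW.
rewrite [p * _]mulnC modnMDl divnMDl ?IH //; last exact: ltnW.
by rewrite addnCA.
Qed.

(** For [e = q * p^n + r] the number [q + r] has the same reduction, and the digit sum of [e] is the
    sum of those of [q] and [r], which bounds that of [q + r]. Then iterate. *)
Lemma digsum_redexp e : digsum p (red e) <= digsum p e.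
Proof.
have [m] := ubnP e; elim: m e => // m IH e hm.
case: (ltnP e P) => h; first by rewrite redexp_small.
have P1 := expn_ge2; have q0 : 0 < e %/ P by rewrite divn_gt0 // ltnW.
have r0 : e %% P < P by rewrite ltn_pmod // ltnW.
have E : e = e %/ P * P.-1 + (e %/ P + e %% P).
  rewrite {1}(divn_eq e P) addnA; congr (_ + _).
  by case: P P1 => // a _ /=; rewrite mulnS addnC.
have E2 : digsum p e = digsum p (e %/ P) + digsum p (e %% P).
  by rewrite -(digsum_expMD _ r0) mulnC -divn_eq.
rewrite {1}E redexpMD ?addn_gt0 ?q0 // E2; apply: leq_trans (digsumD_le p_gt1 _ _).
apply: IH; apply: leq_trans (_ : e <= m) => //.
rewrite [ltnRHS]E -[ltnLHS]add0n ltn_add2r muln_gt0 q0; lia.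
Qed.

End ReducedExponents.

(** * Reduction as a filtered chain map *)

Section Reduction.
Variables p n k : nat.
Hypothesis p_pr : prime p.
Hypothesis n_gt0 : (0 < n)%N.
Hypothesis k_gt0 : (0 < k)%N.

Let p_gt1 : (1 < p)%N := prime_gt1 p_pr.

Local Notation F := 'F_p.
Local Notation d s z := (dcob p n (copT p n k) s z).
Local Notation red := (redS p n n _).

Definition rmon N (m : 'X_{1..N}) : 'X_{1..N} := [multinom redexp p n (m i) | i < N].

Section OneDegree.
Variable s : nat.
Implicit Types x y z : {mpoly F[s * n]}.

Lemma redS_wide z (S : seq 'X_{1..s * n}) : uniq S -> {subset msupp z <= S} ->
  red z = \sum_(m <- S) z@_m *: 'X_[rmon m].
Proof.
move=> uS sub; rewrite (bigID (mem (msupp z))) /= [X in _ + X]big1 ?addr0; last first.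
  by move=> m; rewrite -mcoeff_eq0 => /eqP ->; rewrite scale0r.
rewrite -big_filter; apply: perm_big; apply: uniq_perm; rewrite ?filter_uniq ?msupp_uniq //.
move=> m; rewrite mem_filter; apply/idP/andP => [hm|[]//].
by split=> //; exact: sub.
Qed.

Lemma redSD x y : red (x + y) = red x + red y.
Proof.
pose S := undup (msupp x ++ msupp y).
have uS : uniq S by exact: undup_uniq.
rewrite !(redS_wide uS) => [|m hm|m hm|m /msuppD_le hm]; rewrite ?mem_undup ?mem_cat ?hm ?orbT //.
  by rewrite -big_split; apply: eq_bigr => m _; rewrite mcoeffD scalerDl.
by move: hm; rewrite mem_cat.
Qed.

Lemma redSZ a x : red (a *: x) = a *: red x.
Proof.
rewrite !(redS_wide (msupp_uniq x)) // => [|m /msuppZ_le //].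
by rewrite scaler_sumr; apply: eq_bigr => m _; rewrite mcoeffZ scalerA.
Qed.

Lemma redS0 : red (0 : {mpoly F[s * n]}) = 0.
Proof. by rewrite /redS msupp0 big_nil. Qed.

Lemma redSB x y : red (x - y) = red x - red y.
Proof. by rewrite redSD -scaleN1r redSZ scaleN1r. Qed.

Lemma redS_sum (I : Type) (r : seq I) (Q : pred I) (f : I -> {mpoly F[s * n]}) :
  red (\sum_(i <- r | Q i) f i) = \sum_(i <- r | Q i) red (f i).
Proof. apply: (big_morph (fun z => red z)); [exact: redSD | exact: redS0]. Qed.

Lemma redSX m : red ('X_[m] : {mpoly F[s * n]}) = 'X_[rmon m].
Proof. by rewrite /redS msuppX big_seq1 mcoeffX eqxx scale1r. Qed.

Lemma redSE z : red z = \sum_(m <- msupp z) z@_m *: 'X_[rmon m].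
Proof. by []. Qed.

Lemma rmonD (m m' : 'X_{1..s * n}) : rmon (rmon m + rmon m')%MM = rmon (m + m')%MM.
Proof. by apply/mnmP => i; rewrite !(mnmE, mnmDE) redexpD. Qed.

Lemma redSM x y : red (red x * red y) = red (x * y).
Proof.
have mulE (f : 'X_{1..s * n} -> 'X_{1..s * n}) :
    (\sum_(m <- msupp x) x@_m *: 'X_[f m]) * (\sum_(m <- msupp y) y@_m *: 'X_[f m]) =
    \sum_(m <- msupp x) \sum_(m' <- msupp y) (x@_m * y@_m') *: 'X_[(f m + f m')%MM]
    :> {mpoly F[s * n]}.
  rewrite mulr_suml; apply: eq_bigr => m _; rewrite mulr_sumr; apply: eq_bigr => m' _.
  by rewrite -scalerAl -scalerAr scalerA mpolyXD.
have -> : x * y = \sum_(m <- msupp x) \sum_(m' <- msupp y)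
    (x@_m * y@_m') *: 'X_[(m + m')%MM].
  by rewrite -(mulE id) -!mpolyE.
rewrite (redSE x) (redSE y) (mulE (@rmon _)) !redS_sum.
apply: eq_bigr => m _; rewrite !redS_sum; apply: eq_bigr => m' _.
by rewrite redSZ redSX rmonD redSZ redSX.
Qed.

Lemma redS_congM x x' y y' : red x = red x' -> red y = red y' -> red (x * y) = red (x' * y').
Proof. by move=> E E'; rewrite -redSM E E' redSM. Qed.

Lemma redS_frob x : red (x ^+ (p ^ n)) = red x.
Proof.
rewrite mpoly_expp // redS_sum redSE; apply: eq_bigr => m _.
rewrite redSZ redSX; congr (_ *: 'X_[_]); apply/mnmP => i.
by rewrite !mnmE mulmnE mulnC redexpM.
Qed.

(* x^(p^n) = x after reduction for every x, so reducing exponents commutes with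
   substitution. *)
Lemma redS_exp x e : red (x ^+ redexp p n e) = red (x ^+ e).
Proof.
case: e => [//|e]; rewrite redexpS.
have h := expn_ge2 p_gt1 n_gt0.
have step a q : red (x ^+ (q * (p ^ n).-1 + a).+1) = red (x ^+ a.+1).
  elim: q => [|q IH]; first by rewrite add0n.
  have -> : ((q.+1 * (p ^ n).-1 + a).+1 = (q * (p ^ n).-1 + a) + p ^ n)%N.
    by rewrite mulSn; lia.
  rewrite -IH exprD exprSr; apply: redS_congM => //; exact: redS_frob.
by rewrite [in RHS](divn_eq e (p ^ n).-1) step.
Qed.

End OneDegree.

Local Opaque redS.

(** Substitution may leave the normal forms, hence the outer reduction on both sides; on monomials
    the claim comes down to [redS_exp]. *)
Lemma redS_sub s s' (f : 'I_(s * n) -> {mpoly F[s' * n]}) (z : {mpoly F[s * n]}) :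
  red (sub f (red z)) = red (sub f z).
Proof.
have L : sub f (red z) = \sum_(m <- msupp z) z@_m *: sub f 'X_[rmon m].
  by rewrite (redSE z); exact: sub_sum.
apply: etrans (congr1 (fun t => red t) L) _.
apply: etrans (esym (congr1 (fun t => red t) (subE f z))).
apply: etrans (redS_sum _ _ _) _; apply: etrans (esym (redS_sum _ _ _)).
apply: eq_bigr => m _; apply: etrans (redSZ _ _) _; apply: etrans (esym (redSZ _ _)).
suff E : red (sub f 'X_[rmon m]) = red (sub f 'X_[m]).
  exact: (congr1 (fun t : {mpoly F[s' * n]} => z@_m *: t) E).
apply: etrans (congr1 (fun t => red t) (subX f _)) _.
apply: etrans (esym (congr1 (fun t => red t) (subX f _))).
elim/big_rec2: _ => [//|i x y _ E]; apply: redS_congM E.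
by rewrite mnmE redS_exp.
Qed.

Lemma redS_dcob s (z : {mpoly F[s * n]}) : red (d s (red z)) = red (d s z).
Proof.
rewrite /dcob.
apply: etrans (redS_sum _ _ _) _; apply: etrans (esym (redS_sum _ _ _)).
apply: eq_bigr => i _; apply: etrans (redSZ _ _) _; apply: etrans (esym (redSZ _ _)).
exact: (congr1 (fun t : {mpoly F[s.+1 * n]} => (-1) ^+ i *: t) (redS_sub _ z)).
Qed.

Lemma msupp_redS s (z : {mpoly F[s * n]}) m : m \in msupp (red z) ->
  exists2 m', m' \in msupp z & m = rmon m'.
Proof.
rewrite redSE => /msupp_sum_le/flattenP[l] /mapP[m']; rewrite mem_filter => /andP[_ hm'] ->.
by move=> /msuppZ_le; rewrite msuppX inE => /eqP ->; exists m'.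
Qed.

Lemma bd_redS s M r (z : {mpoly F[s * n]}) : bd (@om n k s) M r z -> bd (@om n k s) M r (red z).
Proof.
move=> h m /msupp_redS[m' /h le ->]; apply: leq_trans le; rewrite leq_add2r.
by apply: leq_sum => v _; rewrite mnmE leq_mul2l digsum_redexp ?orbT.
Qed.

Lemma normalized_redS s (z : {mpoly F[s * n]}) : normalized p s n z -> normalized p s n (red z).
Proof.
move=> h m /msupp_redS[m' hm' ->] b bs; have [v hv] := h m' hm' b bs.
by exists v; rewrite mnmE redexp_gt0.
Qed.

Lemma reducedS_redS s (z : {mpoly F[s * n]}) : reducedS p n n s (red z).
Proof. by move=> m /msupp_redS[m' hm' ->] i; rewrite mnmE redexp_lt. Qed.

(** For [a < n] the index [k + a] is below the recursive range of the May weight, so t_(k+a) and its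
    p-powers weigh as much as those of xi_(k+a). *)
Lemma wtvS_small a e : (a < n)%N -> wtvS p n k a e = ((2 * (k + a) - 1) * digsum p e)%N.
Proof.
move=> an; rewrite /wtvS /digsum big_distrr; apply: eq_bigr => l _ /=.
rewrite mulnC; congr (_ * _)%N; rewrite /MwS.
case: (k + a)%N (leq_addr a k) (ltn_add2l k a n) => [|x] /=; first by lia.
by move=> _ h; rewrite addnC h an.
Qed.

Lemma FsubS s M r z : Fsub p (Scx p n k n) s M r z <-> bd (@om n k s) M r z.
Proof.
have E m : wtC p (Scx p n k n) s m = mwt p (@om n k s) m.
  by apply: eq_bigr => v _; rewrite /= wtvS_small // ord_mod.
by split=> h m hm; have := h m hm; rewrite E.
Qed.

(** The correction [bS] enters only from [a = n] on, so for [N = n] the two coproducts agree. *)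
Lemma dcobS s z : dC p (Scx p n k n) s z = red (d s z).
Proof.
have Ec a : (a < n)%N -> copS p n k n a = copT p n k a.
  by move=> an; rewrite /copS ifF ?subr0 //; lia.
have Ef i : face p n (copS p n k n) s i z = face p n (copT p n k) s i z.
  by apply: eq_sub => v /=; rewrite (Ec _ (ord_mod n_gt0 v)).
have E : dcob p n (copS p n k n) s z = d s z.
  apply: eq_bigr => i _.
  exact: (congr1 (fun t : {mpoly F[s.+1 * n]} => (-1) ^+ i *: t) (Ef i)).
exact: (congr1 (fun t => red t) E).
Qed.

Lemma PhiN_redS s (y : {mpoly F[s * n]}) : PhiN p n n s y = red y.
Proof.
have E : sub (fun v : 'I_(s * n) => blk p s n (v %/ n) (v %% n)) y = y.
  apply: etrans (comp_mpoly_id y); apply: eq_sub => v; exact: blk_ord.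
exact: (congr1 (fun t => red t) E).
Qed.

Lemma survives_Phi T r s M (y : {mpoly F[s * n]}) :
  survives p (Tcx p n k T) r s M y -> survives p (Scx p n k n) r s M (PhiN p n n s y).
Proof.
case=> z [[nz _] [bz [same bdz]]]; rewrite PhiN_redS; exists (red z); split.
  by split; [exact: normalized_redS | exact: reducedS_redS].
split; first by apply/FsubS; exact: bd_redS.
split; last by apply/FsubS; rewrite dcobS redS_dcob; exact: bd_redS.
case: s z y {nz bz bdz} same => [|s] z y.
  by move=> h; apply/FsubS; rewrite -redSB; exact: bd_redS.
case=> w [[nw _] [bw h]]; exists (red w); split.
  by split; [exact: normalized_redS | exact: reducedS_redS].
split; first by apply/FsubS; exact: bd_redS.
by apply/FsubS; rewrite dcobS redS_dcob -!redSB; exact: bd_redS.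
Qed.

End Reduction.

(** * Survival to every page *)

Section Survival.
Variables p n k c : nat.
Hypothesis p_pr : prime p.
Hypothesis p_gt2 : (2 < p)%N.
Hypothesis n_gt0 : (0 < n)%N.
Hypothesis k_gt0 : (0 < k)%N.

Local Notation F := 'F_p.
Local Notation d s z := (dcob p n (copT p n k) s z).
Local Notation C := (Tcx p n k (2 * (p - 1) * c)).

Lemma survives_le r r' s M (y : {mpoly F[s * n]}) : (r <= r')%N ->
  survives p C r' s M y -> survives p C r s M y.
Proof.
move=> le [z [h1 [h2 [h3 h4]]]]; exists z; do !split=> //.
by move=> m /h4; lia.
Qed.

Lemma sameE1_sub s M (z y w : {mpoly F[s * n]}) : bd (@om n k s) M 1 w ->
  sameE1 p C M s z y -> sameE1 p C M s (z - w) y.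
Proof.
move=> bw; case: s z y w bw => [|s] z y w bw /= h.
  have -> : z - w - y = z - y - w by rewrite addrAC.
  exact: bdB h bw.
have [w' [h1 [h2 h3]]] := h; exists w'; split=> //; split=> //.
have -> : z - w - y - dC p C s w' = z - y - dC p C s w' - w.
  by rewrite [RHS]addrAC [z - y - w]addrAC.
exact: bdB h3 bw.
Qed.

(** The target has filtration [M - r] and degree [s.+1], strictly below the line because [r >= 2].
    Vanishing gives [w] in filtration [M - r] with [d s (z - w)] one step lower, and subtracting [w]
    does not change the class of [z]. *)
Lemma survives_step r s M (y : {mpoly F[s * n]}) : (2 <= r)%N -> (M + s = 2 * digsum p c)%N ->
  survives p C r s M y -> survives p C r.+1 s M y.
Proof.
move=> r2 Ms [z [[nz hz] [bz [same bdz]]]].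
have {}bdz : bd (@om n k s.+1) M r (d s z) by exact: bdz.
have {}hz : homg (@dl p n k s) (2 * (p - 1) * c) z by exact: hz.
case: (leqP r M) => rM; last first.
  (* For [r > M] the bound on [d s z] already forces it to be zero; below, [M - r] is an exact
     subtraction. *)
  exists z; split=> //; split=> //; split=> // m hm.
  by have := bdz m hm; lia.
have : sameE1 p C (M - r) s.+1 (d s z) 0.
  apply: vanishing => //.
  - by lia.
  - exact: normalized_dcob.
  - exact: homg_dcob.
  - by apply: bd_le bdz; lia.
  by rewrite dcob_dcob //; exact: bd0.
case=> w [[nw hw] [bw h]].
have {}bw : bd (@om n k s) (M - r) 0 w by exact: bw.
have {}hw : homg (@dl p n k s) (2 * (p - 1) * c) w by exact: hw.
exists (z - w); split.
  split; last exact: homgB.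
  by move=> m /msuppB_le; rewrite mem_cat => /orP[/nz|/nw].
split.
  by apply: (bdB bz); apply: bd_le bw; lia.
split.
  by apply: sameE1_sub => //; apply: bd_le bw; lia.
rewrite /dC /= dcobB; move: h; rewrite subr0 => h.
by apply: bd_le (h : bd (@om n k s.+1) (M - r) 1 (d s z - d s w)); lia.
Qed.

Lemma survives_infinite s M (y : {mpoly F[s * n]}) : (M + s = 2 * digsum p c)%N ->
  survives p C 2 s M y -> infinite_cocycle p C s M y.
Proof.
move=> Ms h r; apply: (@survives_le _ (r + 2)); first exact: leq_addr.
by elim: r => [//|r IH]; rewrite addSn; apply: survives_step IH => //; exact: leq_addl.
Qed.

(** Serves the empty combination: there [s] is tied to nothing, so [M + s = 2 * digsum p c] may fail
    under truncated subtraction. *)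
Lemma survives0 r s M : survives p C r s M 0.
Proof.
have b0 s' M' r' : Fsub p C s' M' r' 0 by move=> m; rewrite msupp0.
have c0 s' : cochain p C s' 0 by split=> m; rewrite msupp0.
have d0 s' : dC p C s' 0 = 0 by rewrite /dC /= dcob0.
exists 0; split=> //; split=> //; split; last by rewrite d0.
case: s => [|s] /=; first by rewrite subrr.
exists 0; split; first exact: c0.
by split; [exact: b0 | rewrite /dC /= dcob0 !subr0; exact: b0].
Qed.

End Survival.

Theorem theorem4p9 (p n k : nat) :
  prime p -> odd p -> (1 <= n)%N -> (1 <= k)%N ->
  (* (1) vanishing line of E_1 *)
  (forall (s M c : nat),
      (M + s < 2 * digsum p c)%N ->
      E1_zero p (Tcx p n k (2 * (p - 1) * c)) s M)
  /\
  (* (2) exterior d_1-cocycles with SI(g) = Sd(g) are infinite cocycles,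
         and so are their images under Phi *)
  (forall (s sigma c : nat) (g : seq ('F_p * word)),
      (forall cw, cw \in g ->
         [/\ size cw.2 = s, word_ok n k cw.2,
             SIw cw.2 = sigma & degw p cw.2 = c]) ->
      sigma = digsum p c ->
      d1_cocycle p (Tcx p n k (2 * (p - 1) * c)) s (2 * sigma - s)
                 (repT p n k s g) ->
      infinite_cocycle p (Tcx p n k (2 * (p - 1) * c)) s (2 * sigma - s)
                       (repT p n k s g)
      /\
      (forall r, exists N, (n <= N)%N /\
         survives p (Scx p n k N) r s (2 * sigma - s)
                  (PhiN p n N s (repT p n k s g)))).
Proof.
move=> p_pr p_odd n_gt0 k_gt0.
have p_gt2 : (2 < p)%N by exact: odd_prime_gt2.
split=> [s M c hM z [nz hz] bz bdz|s sigma c g hg Es h]; first exact: vanishing.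
have inf : infinite_cocycle p (Tcx p n k (2 * (p - 1) * c)) s (2 * sigma - s) (repT p n k s g).
  case: g hg h => [|cw g] hg h.
    by rewrite /repT big_nil => r; exact: survives0.
  apply: survives_infinite h => //; rewrite -Es.
  have [sz ok <- _] := hg cw (mem_head _ _).
  (* Every index is at least [k >= 1], so the length is at most SI and [2 * sigma - s] is an exact
     subtraction. *)
  suff le : (s <= SIw cw.2)%N by rewrite subnK // (leq_trans le) // leq_pmull.
  rewrite -sz /SIw -sum1_size big_seq [leqRHS]big_seq; apply: leq_sum => ij hij.
  by have /andP[] := allP ok ij hij; lia.
split=> // r; exists n; split=> //.
exact: survives_Phi (inf r).
Qed.
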